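(* Let $X\subset\mathbb{P}^n$ be a $k$-dimensional complete intersection variety of multidegree $(d_1,\dots,d_{n-k})$ such that $X$ is nonsingular in codimension $1$. If $X$ is invariant under a Pfaff field $\mathcal{F}$ of rank $k$ on $\mathbb{P}^n$, then $$d_1+\cdots+d_{n-k}\leq\deg(\mathcal{F})+n-k+1.$$
   Context: We work over $\mathbb{C}$. ''Nonsingular in codimension $1$'' means $\mathrm{codim}(Sing(X),X)\geq 2$. Pfaff fields: a Pfaff field $\mathcal{F}$ of rank $k$ ($0<k<n$) on $\mathbb{P}^n$ is a nonzero global section of $\bigwedge^k\Theta_{\mathbb{P}^n}\otimes\mathcal{O}_{\mathbb{P}^n}(s)$ for some $s\in\mathbb{Z}$, where $\Theta_{\mathbb{P}^n}$ is the tangent bundle; its degree is $\deg(\mathcal{F})=s+k$. Equivalently, $\mathcal{F}$ is a nonzero map $\xi_{\mathcal{F}}^\vee:\Omega^k_{\mathbb{P}^n}\to N$ with $N=\mathcal{O}_{\mathbb{P}^n}(s)$. The singular set $Sing(\mathcal{F})$ is the set of points $x\in\mathbb{P}^n$ at which $\xi_{\mathcal{F}}^\vee(x)$ is not surjective. Invariance: a closed subscheme $X\subset\mathbb{P}^n$ with $\dim X\geq k$ is invariant under $\mathcal{F}$ if $X\not\subset Sing(\mathcal{F})$ and there is a morphism of sheaves $\phi:\Omega^k_X\to N|_X$ such that $\xi_{\mathcal{F}}^\vee|_X:\Omega^k_{\mathbb{P}^n}|_X\to N|_X$ is the composition of the natural map $\Omega^k_{\mathbb{P}^n}|_X\to\Omega^k_X$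 with $\phi$. *)

(* Defs.v *)
From HB Require Import structures.
From mathcomp Require Import all_boot all_order all_algebra.
From mathcomp Require Import mpoly complex.
From mathcomp Require Import boolp classical_sets reals.

Set Implicit Arguments.
Unset Strict Implicit.
Unset Printing Implicit Defensive.

Import Order.TTheory GRing.Theory Num.Theory.
Local Open Scope ring_scope.
Local Open Scope classical_set_scope.

(* Varieties over an algebraically closed field C are treated classically,
   through their closed points and their sheaves of C-valued functions.
   A point of P^n is given by its homogeneous coordinates, that is by any of
   its nonzero representatives in C^(n+1).  Accordingly, a subset of P^n is
   represented by its punctured affine cone in C^(n+1) \ {0}. *)
Definition coords (C : closedFieldType) (n : nat) := 'I_n.+1 -> C.

Definition projective_space (C : closedFieldType) (n : nat) :
    set (coords C n) :=
  [set p | exists i, p i != 0].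

Definition proj_point (C : closedFieldType) (n : nat) (p : coords C n) :
    set (coords C n) :=
  [set q | exists2 c : C, c != 0 & q = (fun i => c * p i)].

Definition zclosed (C : closedFieldType) (n : nat) (Z : set (coords C n)) :=
  exists F : set {mpoly C[n.+1]},
    (forall f, F f -> exists d : nat, f \is d.-homog) /\
    Z = [set p | projective_space p /\ forall f, F f -> f.@[p] = 0].

Definition zopen_in (C : closedFieldType) (n : nat)
    (Y U : set (coords C n)) :=
  exists2 Z, zclosed Z & U = Y `\` Z.

Definition irreducible_closed (C : closedFieldType) (n : nat)
    (Z : set (coords C n)) :=
  [/\ zclosed Z, Z !=set0 &
      forall A B, zclosed A -> zclosed B ->
        Z `<=` A `|` B -> Z `<=` A \/ Z `<=` B].

(* Z 0 < Z 1 < ... < Z l, irreducible closed subsets of X; values of Z beyond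
   l are irrelevant. *)
Definition irreducible_chain (C : closedFieldType) (n : nat)
    (X : set (coords C n)) (l : nat) (Z : nat -> set (coords C n)) :=
  [/\ forall i, (i <= l)%N -> irreducible_closed (Z i),
      forall i, (i < l)%N -> Z i `<` Z i.+1 &
      Z l `<=` X].

Definition has_dim (C : closedFieldType) (n : nat)
    (X : set (coords C n)) (k : nat) :=
  (exists Z, irreducible_chain X k Z) /\
  (forall l Z, irreducible_chain X l Z -> (l <= k)%N).

(* codim (Y, X) = c for an irreducible closed subset Y of X. *)
Definition has_codim (C : closedFieldType) (n : nat)
    (Y X : set (coords C n)) (c : nat) :=
  (exists2 Z, irreducible_chain X c Z & Z 0%N = Y) /\
  (forall l Z, irreducible_chain X l Z -> Z 0%N = Y -> (l <= c)%N).

(* c <= codim (Y, X) for a closed subset Y of X: the codimension of Y is the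
   infimum of those of its irreducible closed subsets, so that the empty set
   has infinite codimension. *)
Definition codim_ge (C : closedFieldType) (n : nat)
    (Y X : set (coords C n)) (c : nat) :=
  forall W, irreducible_closed W -> W `<=` Y ->
    exists2 Z, irreducible_chain X c Z & Z 0%N = W.

(* Sections over U of O(e), for a (relatively) open subset U of a reduced
   closed subscheme of P^n: the functions on the cone over U which are locally
   quotients g / h of homogeneous polynomials with deg g - deg h = e.  The
   neighbourhoods may be taken of the form "h != 0" since these form a basis.
   Only the values on U are significant.  For e = 0 these are the regular
   functions on U. *)
Definition twist_section (C : closedFieldType) (n : nat) (e : int)
    (U : set (coords C n)) (sigma : coords C n -> C) :=
  forall p, U p ->
    exists (dg dh : nat) (g h : {mpoly C[n.+1]}),
      [/\ dg%:Z = dh%:Z + e,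
          g \is dg.-homog, h \is dh.-homog, h.@[p] != 0 &
          forall q, U q -> h.@[q] != 0 -> sigma q = g.@[q] / h.@[q]].

Definition regular_on (C : closedFieldType) (n : nat)
    (U : set (coords C n)) (f : coords C n -> C) := twist_section 0 U f.

(* The local ring O_(X,p) is regular: its maximal ideal is generated by c
   elements, where c = dim O_(X,p) is the codimension of {p} in X. *)
Definition nonsingular_at (C : closedFieldType) (n : nat)
    (X : set (coords C n)) (p : coords C n) :=
  exists2 c, has_codim (proj_point p) X c &
  exists (U : set (coords C n)) (t : 'I_c -> coords C n -> C),
    [/\ zopen_in X U, U p,
        forall i, regular_on U (t i) /\ t i p = 0 &
        forall V f, zopen_in X V -> V p -> regular_on V f -> f p = 0 ->
          exists (W : set (coords C n)) (g : 'I_c -> coords C n -> C),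
            [/\ zopen_in X W, W p, W `<=` U `&` V,
                forall i, regular_on W (g i) &
                forall q, W q -> f q = \sum_(i < c) g i q * t i q]].

Definition sing_locus (C : closedFieldType) (n : nat)
    (X : set (coords C n)) : set (coords C n) :=
  [set p | X p /\ ~ nonsingular_at X p].

Definition nonsingular_in_codim1 (C : closedFieldType) (n : nat)
    (X : set (coords C n)) := codim_ge (sing_locus X) X 2.

Definition subst_at (k : nat) (T : Type) (a : 'I_k -> T) (i : 'I_k) (x : T) :
    'I_k -> T :=
  fun j => if j == i then x else a j.

(* Morphisms of O_Y-modules Omega^k_Y -> O_Y(s).  The sheaf Omega^k_Y is
   generated by the symbols d(a 0) /\ ... /\ d(a (k-1)), a i in O_Y, subject to
   C-multilinearity, the Leibniz rule and alternation; hence a morphism D out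
   of it is exactly a morphism of sheaves O_Y x ... x O_Y -> O_Y(s) obeying
   these relations:
     D U a = D (d(a 0) /\ ... /\ d(a (k-1)))   for a i in O_Y(U).
   The field form_res expresses both that D U a depends only on the values of
   the a i on U and that D commutes with restriction. *)
Record form_morphism (C : closedFieldType) (n k : nat) (s : int)
    (Y : set (coords C n))
    (D : set (coords C n) -> ('I_k -> coords C n -> C) -> coords C n -> C) :
    Prop := FormMorphism {
  form_section : forall U a, zopen_in Y U -> (forall i, regular_on U (a i)) ->
    twist_section s U (D U a);
  form_res : forall U V a b, zopen_in Y U -> zopen_in Y V -> V `<=` U ->
    (forall i, regular_on U (a i)) -> (forall i, regular_on V (b i)) ->
    (forall i p, V p -> a i p = b i p) ->
    forall p, V p -> D U a p = D V b p;
  form_linear : forall U a i (c : C) f g, zopen_in Y U ->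
    (forall j, regular_on U (a j)) -> regular_on U f -> regular_on U g ->
    forall p, U p ->
      D U (subst_at a i (fun q => c * f q + g q)) p =
      c * D U (subst_at a i f) p + D U (subst_at a i g) p;
  form_leibniz : forall U a i f g, zopen_in Y U ->
    (forall j, regular_on U (a j)) -> regular_on U f -> regular_on U g ->
    forall p, U p ->
      D U (subst_at a i (fun q => f q * g q)) p =
      f p * D U (subst_at a i g) p + g p * D U (subst_at a i f) p;
  form_alternating : forall U a i j, zopen_in Y U ->
    (forall l, regular_on U (a l)) -> i != j ->
    (forall q, U q -> a i q = a j q) ->
    forall p, U p -> D U a p = 0
}.

(* A nonzero morphism Omega^k -> O(s) on P^n, equivalently a nonzero global
   section of the k-th exterior power of the tangent bundle twisted by s. *)
Record pfaff_field (C : closedFieldType) (n k : nat) := PfaffField {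
  pfaff_twist : int;
  pfaff_map :
    set (coords C n) -> ('I_k -> coords C n -> C) -> coords C n -> C;
  pfaff_morphism : form_morphism pfaff_twist (@projective_space C n) pfaff_map;
  pfaff_neq0 : exists U a p,
    [/\ zopen_in (@projective_space C n) U, forall i, regular_on U (a i),
        U p & pfaff_map U a p != 0]
}.

Definition pfaff_degree (C : closedFieldType) (n k : nat)
    (F : pfaff_field C n k) : int := pfaff_twist F + k%:Z.

(* Evaluation at p identifies the fibre of O(s) with C.  The values reached by
   the generators d(a 0) /\ ... /\ d(a (k-1)) are stable under scaling, so they
   already make up the whole image of the map on fibres. *)
Definition pfaff_sing (C : closedFieldType) (n k : nat)
    (F : pfaff_field C n k) : set (coords C n) :=
  [set p | projective_space p /\
    ~ (forall c : C, exists U a,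
         [/\ zopen_in (@projective_space C n) U, U p,
             forall i, regular_on U (a i) & pfaff_map F U a p = c])].

(* The factorization through phi is tested on the generators
   d(a 0) /\ ... /\ d(a (k-1)) of Omega^k of P^n, which the natural map sends
   to the corresponding generators for the restrictions of the a i to X. *)
Definition pfaff_invariant (C : closedFieldType) (n k : nat)
    (F : pfaff_field C n k) (X : set (coords C n)) :=
  ~ (X `<=` pfaff_sing F) /\
  exists2 phi, form_morphism (k := k) (pfaff_twist F) X phi &
    forall U a, zopen_in (@projective_space C n) U ->
      (forall i, regular_on U (a i)) ->
      forall p, (U `&` X) p -> phi (U `&` X) a p = pfaff_map F U a p.

(* The homogeneous ideal of X is generated by r forms of degrees d.  As X is
   given by its cone, its homogeneous ideal consists of the polynomials
   vanishing on that cone.  This defines complete intersections when r is the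
   codimension of X in P^n. *)
Definition ideal_generated_in_degrees (C : closedFieldType) (n r : nat)
    (X : set (coords C n)) (d : 'I_r -> nat) :=
  exists f : 'I_r -> {mpoly C[n.+1]},
    (forall i, f i != 0 /\ f i \is (d i).-homog) /\
    (forall g : {mpoly C[n.+1]},
       (forall p, X p -> g.@[p] = 0) <->
       exists q : 'I_r -> {mpoly C[n.+1]}, g = \sum_(i < r) q i * f i).

Definition complete_intersection_variety (C : closedFieldType) (n k : nat)
    (X : set (coords C n)) (d : 'I_(n - k) -> nat) :=
  [/\ irreducible_closed X, has_dim X k & ideal_generated_in_degrees X d].
Arguments complete_intersection_variety {C n} k X d.

(* Main.v *)
Require Import Defs.
From HB Require Import structures.
From mathcomp Require Import all_boot all_order all_algebra all_fingroup.
From mathcomp Require Import mpoly complex.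
From mathcomp Require Import boolp classical_sets reals.
From mathcomp Require Import ring zify.

Set Implicit Arguments.
Unset Strict Implicit.
Unset Printing Implicit Defensive.

Import Order.TTheory GRing.Theory Num.Theory.
Local Open Scope ring_scope.
Local Open Scope classical_set_scope.

(** Let X be given by the forms f_1, ..., f_r of degrees d_j, r = n - k, and let
    phi be the morphism from k-forms on X to O(s) induced by the Pfaff field.

    At a point where the gradients of the f_j are independent the tangent space
    of X has dimension k, so phi is there a multiple of the volume form. This
    multiple is the section residue: phi of k chart coordinates, divided by the
    determinant of the gradients of the f_j together with these coordinates
    (forms_proportional, residueE). Counting degrees, it is a section of O(m)
    with m = s + n + 1 - sum d_j (residue_section); it does not vanish
    identically, for otherwise phi would vanish, and X would lie in the singular
    set of the field (residue_eq0). The bound to be proved says m >= 0.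

    By the Jacobian criterion (nonsingular_jacobian_rank) the gradients are
    dependent only at singular points, so the residue is defined outside a
    closed subset of codimension at least 2. It remains to see that such a
    section sigma is zero when m < 0 (negative_section_eq0). On a normal X it
    would extend; normality is avoided as follows.

    The homogeneous coordinate ring R of X is finite over a polynomial ring
    B[z], B = C[l_1, ..., l_m'], such that the ideal D of denominators of sigma
    contains a polynomial beta monic in z (relative_normalization). If D met B
    in 0, some irreducible W on which sigma has poles would dominate Spec B
    (exists_dominant_irreducible); a chain W < Z_1 < Z_2 in X would trace on
    B[z] a chain of two nonzero primes meeting B in 0, which is absurd
    (prime_poly_height1). So D contains a nonzero r of B beside beta. As r and
    beta form a regular sequence on B[z], there is one c != 0 in B[z] with
    c sigma^j in R for all j (bounded_denominator). But c sigma^j is a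
    polynomial of negative degree for large j, so sigma = 0. *)

(** * Ideals as sets, and integrality modulo an ideal *)

Record is_ideal (P : comNzRingType) (I : set P) : Prop := IsIdeal {
  ideal_0 : I 0;
  ideal_D : forall x y, I x -> I y -> I (x + y);
  ideal_M : forall a x, I x -> I (a * x)
}.

Record is_prime_ideal (P : comNzRingType) (I : set P) : Prop := IsPrimeIdeal {
  prime_ideal : is_ideal I;
  prime_proper : ~ I 1;
  prime_M : forall x y, I (x * y) -> I x \/ I y
}.

Lemma ideal_N (P : comNzRingType) (I : set P) : is_ideal I ->
  forall x, I x -> I (- x).
Proof. by move=> hI x Ix; rewrite -mulN1r; apply: ideal_M. Qed.

Lemma ideal_B (P : comNzRingType) (I : set P) : is_ideal I ->
  forall x y, I x -> I y -> I (x - y).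
Proof. by move=> hI x y Ix Iy; apply: ideal_D => //; apply: ideal_N. Qed.

Lemma ideal_Mr (P : comNzRingType) (I : set P) : is_ideal I ->
  forall a x, I x -> I (x * a).
Proof. by move=> hI a x Ix; rewrite mulrC; apply: ideal_M. Qed.

Lemma ideal_sum (P : comNzRingType) (I : set P) (J : Type) (r : seq J)
    (Q : pred J) (F : J -> P) : is_ideal I ->
  (forall i, Q i -> I (F i)) -> I (\sum_(i <- r | Q i) F i).
Proof.
by move=> hI hF; apply: big_ind => //; [exact: ideal_0 | exact: ideal_D].
Qed.

Lemma ideal_subl (P : comNzRingType) (I : set P) : is_ideal I ->
  forall x y, I (x - y) -> I x <-> I y.
Proof.
move=> hI x y Ixy; split=> h.
  by rewrite -[y](subKr x); apply: ideal_B.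
by rewrite -[x](subrK y); apply: ideal_D.
Qed.

Lemma prime_X (P : comNzRingType) (I : set P) : is_prime_ideal I ->
  forall x n, I (x ^+ n) -> I x.
Proof.
move=> hI x; elim=> [|n IHn]; first by rewrite expr0 => /(prime_proper hI).
by rewrite exprS => /(prime_M hI)[|/IHn].
Qed.

Definition integral_mod (A P : comNzRingType) (theta : A -> P) (I : set P)
    (f : P) := exists2 p : {poly A}, p \is monic & I (map_poly theta p).[f].

Lemma exists_quotient (P : comNzRingType) (I : set P) :
  is_ideal I -> ~ I 1 ->
  exists (K : comNzRingType) (pi : {rmorphism P -> K}),
    (forall x, pi x = 0 <-> I x) /\ (forall y, exists x, pi x = y).
Proof.
move=> hI I1; pose Ib : P -> bool := fun x => `[< I x >].
have Ic : idealr_closed Ib.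
  split.
  - by apply/asboolP; apply: (ideal_0 hI).
  - by apply/negP => /asboolP.
  - move=> a u v /asboolP Iu /asboolP Iv; apply/asboolP.
    by apply: ideal_D => //; apply: ideal_M.
pose J : Idealr.type P := HB.pack_for (Idealr.type P) Ib (isIdealr.Build P _ Ic).
pose Q := {ideal_quot J}.
pose pi : {rmorphism P -> Q} := (\pi_Q)%qT.
exists Q, pi; split=> [x|y]; last by exists (generic_quotient.repr y); rewrite /pi /= reprK.
have -> : (pi x = 0) <-> (x - 0 \in J).
  rewrite Quotient.idealrBE; split=> [h|/eqP h].
    by apply/eqP; move: h; rewrite -(rmorph0 pi).
  by rewrite -(rmorph0 pi).
by rewrite subr0 unfold_in; split=> /asboolP.
Qed.

Lemma integral_quotE (A P K : comNzRingType) (theta : {rmorphism A -> P}) (I : set P)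
    (pi : {rmorphism P -> K}) f : (forall x, pi x = 0 <-> I x) ->
  integral_mod theta I f <-> integralOver (pi \o theta) (pi f).
Proof.
move=> piE; split=> -[p p_monic h]; exists p => //.
  by rewrite map_poly_comp rootE horner_map; apply/eqP/piE.
by apply/piE; rewrite -horner_map -map_poly_comp; apply/eqP.
Qed.

Lemma integral_trivial (A P : comNzRingType) (theta : {rmorphism A -> P})
  (I : set P) f : I 1 -> integral_mod theta I f.
Proof. by exists 1; rewrite ?monic1 // rmorph1 hornerC. Qed.

Section IntegralMod.
Variables (A P : comNzRingType) (theta : {rmorphism A -> P}) (I : set P).
Hypothesis hI : is_ideal I.

Lemma integral_mod_id a : integral_mod theta I (theta a).
Proof.
have [|/(exists_quotient hI)[K [pi [piE _]]]] := pselect (I 1); first exact: integral_trivial.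
by apply/(integral_quotE _ _ piE); exact: (integral_id (pi \o theta)).
Qed.

Lemma integral_mod_D f g : integral_mod theta I f -> integral_mod theta I g ->
  integral_mod theta I (f + g).
Proof.
have [|/(exists_quotient hI)[K [pi [piE _]]]] := pselect (I 1).
  by move=> *; apply: integral_trivial.
move=> /(integral_quotE _ _ piE) hf /(integral_quotE _ _ piE) hg.
by apply/(integral_quotE _ _ piE); rewrite rmorphD; apply: integral_add.
Qed.

Lemma integral_mod_M f g : integral_mod theta I f -> integral_mod theta I g ->
  integral_mod theta I (f * g).
Proof.
have [|/(exists_quotient hI)[K [pi [piE _]]]] := pselect (I 1).
  by move=> *; apply: integral_trivial.
move=> /(integral_quotE _ _ piE) hf /(integral_quotE _ _ piE) hg.
by apply/(integral_quotE _ _ piE); rewrite rmorphM; apply: integral_mul.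
Qed.

Lemma integral_mod_trans (B : comNzRingType) (eta : {rmorphism B -> P}) f :
  (forall a, integral_mod eta I (theta a)) -> integral_mod theta I f ->
  integral_mod eta I f.
Proof.
have [|/(exists_quotient hI)[K [pi [piE _]]]] := pselect (I 1).
  by move=> *; apply: integral_trivial.
move=> hA /(integral_quotE _ _ piE)[p p_monic hp]; apply/(integral_quotE _ _ piE).
apply: (integral_root_monic _ hp); first exact: monic_map.
apply/integral_poly => i; rewrite coef_map /=.
exact/(integral_quotE _ _ piE).
Qed.

Lemma integral_mod_sub (J : set P) f : I `<=` J ->
  integral_mod theta I f -> integral_mod theta J f.
Proof. by move=> IJ [p p_monic hp]; exists p => //; apply: IJ. Qed.

End IntegralMod.

(** Dividing an integral equation of f by f as long as its constant term lies
    in I, one reaches an equation whose constant term does not; that term is a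
    multiple of f modulo I. *)
Lemma integral_contract (A P : comNzRingType) (theta : {rmorphism A -> P})
    (I : set P) (f : P) :
  is_prime_ideal I -> integral_mod theta I f -> ~ I f ->
  exists a g, ~ I (theta a) /\ I (theta a - f * g).
Proof.
move=> hI [p p_monic hp] nIf.
have hI' := prime_ideal hI.
have : (exists i, ~ I (theta p`_i)).
  exists (size p).-1; rewrite -lead_coefE (monicP p_monic) rmorph1.
  exact: prime_proper hI.
elim: {p}_.+1 {-2}p (ltnSn (size p)) hp {p_monic} => // N IHN p pN hp [i hi].
have Ep : p = (drop_poly 1 p) * 'X + (p`_0)%:P.
  rewrite -{1}(poly_take_drop 1 p) addrC expr1; congr (_ + _).
  by apply/polyP=> -[|j]; rewrite coef_take_poly coefC.
have hp' : (map_poly theta p).[f]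
    = (map_poly theta (drop_poly 1 p)).[f] * f + theta p`_0.
  by rewrite {1}Ep rmorphD rmorphM /= map_polyX map_polyC !hornerE.
have [I0|nI0] := pselect (I (theta p`_0)); last first.
  exists p`_0, (- (map_poly theta (drop_poly 1 p)).[f]); split=> //.
  by rewrite mulrN opprK addrC mulrC -hp'.
have : I ((map_poly theta (drop_poly 1 p)).[f] * f).
  move: hp; rewrite hp'; apply: (iffLR (ideal_subl hI' _)).
  by rewrite addrC addKr.
case/(prime_M hI) => // h.
case: i hi => [//|i] hi.
have iN : (i.+1 < size p)%N.
  by rewrite ltnNge; apply/negP => h1; apply: hi; rewrite nth_default // rmorph0; apply: ideal_0.
apply: (IHN _ _ h); last by exists i; rewrite coef_drop_poly addn1.
by rewrite size_drop_poly subn1 -ltnS prednK // (leq_trans _ iN).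
Qed.

Lemma exists_minimal (T : Type) (Q : T -> Prop) (mu : T -> nat) :
  (exists x, Q x) -> exists x, Q x /\ forall y, Q y -> (mu x <= mu y)%N.
Proof.
move=> [x0 Qx0].
have ex : exists k, `[< exists x, Q x /\ mu x = k >].
  by exists (mu x0); apply/asboolP; exists x0.
case: (ex_minnP ex) => k /asboolP[x [Qx xk]] hk.
by exists x; split=> // y Qy; rewrite xk; apply: hk; apply/asboolP; exists y.
Qed.

(** * Maximal ideals avoiding a multiplicative set *)

Definition closed_under (P : Type) (Rel : P -> P -> Prop) (I : set P) :=
  forall f g, I f -> Rel f g -> I g.

Definition ideal_adjoin (P : comNzRingType) (I : set P) (x : P) : set P :=
  [set u | exists m a, I m /\ u = m + a * x].

Lemma ideal_adjoin_ideal (P : comNzRingType) (I : set P) (x : P) :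
  is_ideal I -> is_ideal (ideal_adjoin I x).
Proof.
move=> hI; split.
- by exists 0, 0; split; [exact: ideal_0 | rewrite mul0r addr0].
- move=> _ _ [m [a [Im ->]]] [m' [a' [Im' ->]]]; exists (m + m'), (a + a').
  by split; [exact: ideal_D | ring].
- move=> b _ [m [a [Im ->]]]; exists (b * m), (b * a).
  by split; [exact: ideal_M | ring].
Qed.

Lemma sub_ideal_adjoin (P : comNzRingType) (I : set P) (x : P) :
  I `<=` ideal_adjoin I x.
Proof. by move=> m Im; exists m, 0; rewrite mul0r addr0. Qed.

Lemma mem_ideal_adjoin (P : comNzRingType) (I : set P) (x : P) :
  is_ideal I -> ideal_adjoin I x x.
Proof.
by move=> hI; exists 0, 1; split; [exact: ideal_0 | rewrite mul1r add0r].
Qed.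

(** Rel restricts the ideals that compete: the empty relation admits all of
    them, the relation between a polynomial and its homogeneous components only
    the homogeneous ones. *)
Definition maximal_avoiding (P : comNzRingType) (Rel : P -> P -> Prop)
    (T M : set P) :=
  [/\ is_ideal M, closed_under Rel M, (forall x, M x -> ~ T x) &
      forall M', is_ideal M' -> closed_under Rel M' -> M `<=` M' ->
        (forall x, M' x -> ~ T x) -> M' `<=` M].

Lemma exists_maximal_avoiding (P : comNzRingType) (Rel : P -> P -> Prop)
    (T J : set P) :
  is_ideal J -> closed_under Rel J -> (forall x, J x -> ~ T x) ->
  exists2 M, maximal_avoiding Rel T M & J `<=` M.
Proof.
move=> hJ cJ JT.
pose good M := [/\ is_ideal M, closed_under Rel M, J `<=` M &
  forall x, M x -> ~ T x].
have hgood : good J by split.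
have [F Fgood totF|M [[M0|Mgood] Mmax]] :=
    @Zorn_bigcup P [set M | M = set0 \/ good M].
- have [[M0 FM0 [x0 M0x0]]|F0] := pselect (exists2 M, F M & M !=set0); last first.
    left; apply/seteqP; split=> x //= [M FM Mx]; case: F0.
    by exists M => //; exists x.
  have pick M x : F M -> M x -> good M.
    by move=> FM Mx; case: (Fgood _ FM) => // M0E; rewrite M0E in Mx.
  have pair M x M' x' : F M -> M x -> F M' -> M' x' ->
      exists M'', [/\ F M'', M'' x & M'' x'].
    move=> FM Mx FM' Mx'; case: (totF _ _ FM FM') => MM'.
      by exists M'; split=> //; apply: MM'.
    by exists M; split=> //; apply: MM'.
  right; split.
  + split.
    * by exists M0 => //; case: (pick _ _ FM0 M0x0) => h _ _ _; apply: ideal_0.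
    * move=> x y [M FM Mx] [M' FM' My].
      have [M'' [FM'' Mx'' My'']] := pair _ _ _ _ FM Mx FM' My.
      exists M'' => //; case: (pick _ _ FM'' Mx'') => h _ _ _.
      exact: ideal_D.
    * move=> a x [M FM Mx]; exists M => //.
      by case: (pick _ _ FM Mx) => h _ _ _; apply: ideal_M.
  + move=> f g [M FM Mf] fg; exists M => //.
    by case: (pick _ _ FM Mf) => _ h _ _; apply: h fg.
  + move=> x Jx; exists M0 => //.
    by case: (pick _ _ FM0 M0x0) => _ _ h _; apply: h.
  + by move=> x [M FM Mx]; case: (pick _ _ FM Mx) => _ _ _; apply.
- case: (Mmax J); last by right.
  rewrite M0; split; first by move=> x.
  by move=> /(_ 0 (ideal_0 hJ)).
- case: (Mgood) => hM cM JM MT; exists M => //; split=> // M' hM' cM' MM' M'T.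
  move=> x M'x; apply: contrapT => nMx.
  case: (Mmax M'); first by split=> // /(_ _ M'x).
  by right; split=> // y /JM /MM'.
Qed.

Lemma maximal_avoiding_prime (P : comNzRingType) (Rel : P -> P -> Prop)
    (T M : set P) (x y : P) :
  maximal_avoiding Rel T M -> (forall s t, T s -> T t -> T (s * t)) ->
  closed_under Rel (ideal_adjoin M x) -> closed_under Rel (ideal_adjoin M y) ->
  M (x * y) -> M x \/ M y.
Proof.
move=> [hM cM MT Mmax] TM cx cy Mxy.
have key z : closed_under Rel (ideal_adjoin M z) -> ~ M z ->
    exists2 t, ideal_adjoin M z t & T t.
  move=> cz nMz; apply: contrapT => h; apply: nMz.
  apply: (Mmax (ideal_adjoin M z)) => //.
  - exact: ideal_adjoin_ideal.
  - exact: sub_ideal_adjoin.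
  - by move=> t Mt Tt; apply: h; exists t.
  - exact: mem_ideal_adjoin.
apply: contrapT => /not_orP[/(key _ cx)[_ [m [a [Mm ->]]] Tt]
                            /(key _ cy)[_ [m' [a' [Mm' ->]]] Tt']].
apply: (MT _ _ (TM _ _ Tt Tt')).
have -> : (m + a * x) * (m' + a' * y)
   = m * (m' + a' * y) + a * x * m' + (a * a') * (x * y) by ring.
apply: ideal_D => //; last exact: ideal_M.
by apply: ideal_D => //; [exact: ideal_Mr | exact: ideal_M].
Qed.

(** Choose Q maximal among the ideals over I whose trace lies in m. Were some t
    of m outside Q, a multiple u t of t would be congruent modulo Q to an s
    outside m; an integral equation of u, multiplied by a power of t, would then
    put a power of s in m. *)
Lemma lying_over (B P : comNzRingType) (theta : {rmorphism B -> P})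
    (I : set P) (m : set B) :
  is_ideal I -> is_prime_ideal m -> (forall f, integral_mod theta I f) ->
  (forall b, I (theta b) -> m b) ->
  exists Q, [/\ is_prime_ideal Q, I `<=` Q & forall b, Q (theta b) <-> m b].
Proof.
move=> hI hm intI Im.
have hm' := prime_ideal hm.
pose T : set P := [set x | exists2 b, ~ m b & x = theta b].
have [||Q Qmax IQ] := @exists_maximal_avoiding P (fun _ _ => False) T I hI.
- by [].
- by move=> x Ix [b nb xb]; apply/nb/Im; rewrite -xb.
have [hQ _ QT _] := Qmax.
have TM s t : T s -> T t -> T (s * t).
  move=> [b nb ->] [c nc ->]; exists (b * c); last by rewrite rmorphM.
  by move/(prime_M hm) => [].
have primeQ : is_prime_ideal Q.
  split=> // [Q1|x y]; last exact: maximal_avoiding_prime Qmax _ _ _.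
  by apply: (QT _ Q1); exists 1; [exact: prime_proper hm | rewrite rmorph1].
exists Q; split=> // t; split=> [Qt|mt].
  by apply: contrapT => nt; apply: (QT _ Qt); exists t.
apply: contrapT => nQt.
have [[_ [q [u [Qq ->]]] [s ns Es]]|nex] := pselect (exists2 x,
    ideal_adjoin Q (theta t) x & T x); last first.
  apply: nQt; case: Qmax => _ _ _ /(_ (ideal_adjoin Q (theta t))); apply.
  - exact: ideal_adjoin_ideal.
  - by [].
  - exact: sub_ideal_adjoin.
  - by move=> x Qx Tx; apply: nex; exists x.
  - exact: mem_ideal_adjoin.
have [p p_monic /IQ hp] := intI u.
set N := (size p).-1.
have sp : size p = N.+1 by rewrite /N prednK // size_poly_gt0 monic_neq0.
have Qs : Q (u * theta t - theta s).
  by rewrite -Es opprD addrCA subrr addr0; apply: ideal_N.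
pose b := \sum_(i < N.+1) p`_i * (t ^+ (N - i) * s ^+ i).
have mb : m b.
  have QE : Q (theta b); last by apply: contrapT => nb; apply: (QT _ QE); exists b.
  have : Q (theta t ^+ N * (map_poly theta p).[u]) by apply: ideal_M.
  apply: (iffLR (ideal_subl hQ _)).
  rewrite horner_coef size_map_poly_id0; last first.
    by rewrite (monicP p_monic) rmorph1 oner_neq0.
  rewrite sp mulr_sumr /b rmorph_sum /= -sumrB; apply: ideal_sum => // i _.
  rewrite coef_map !rmorphM !rmorphXn /=.
  have -> : theta t ^+ N = theta t ^+ (N - i) * theta t ^+ i.
    by rewrite -exprD subnK // -ltnS.
  have -> : theta t ^+ (N - i) * theta t ^+ i * (theta p`_i * u ^+ i)
     - theta p`_i * (theta t ^+ (N - i) * theta s ^+ i)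
     = (theta p`_i * theta t ^+ (N - i)) * ((u * theta t) ^+ i - theta s ^+ i).
    by rewrite exprMn; ring.
  by apply: ideal_M => //; rewrite subrXX; apply: ideal_Mr.
apply: ns; apply: (prime_X hm (n := N)).
move: mb; rewrite /b big_ord_recr /= subnn expr0 mul1r.
have -> : p`_N = 1 by rewrite -(monicP p_monic).
rewrite mul1r => mb.
have mS : m (\sum_(i < N) p`_i * (t ^+ (N - i) * s ^+ i)).
  apply: ideal_sum => // i _; apply: ideal_M => //; apply: ideal_Mr => //.
  have Ni : (0 < N - i)%N by rewrite subn_gt0.
  by rewrite -(prednK Ni) exprS; apply: ideal_Mr.
by have := ideal_B hm' mb mS; rewrite addrAC subrr add0r.
Qed.

(** Over the fraction field of B ideals of polynomials are principal. Hence p0,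
    which meets B in 0, is generated up to denominators in B by an element of
    least degree, and no nonzero prime lies strictly below it. *)
Lemma prime_poly_height1 (B : idomainType) (p0 p1 : set {poly B}) :
  is_ideal p0 -> is_prime_ideal p1 -> p1 `<=` p0 ->
  (forall b : B, p0 b%:P -> b = 0) -> (exists2 g, p1 g & g != 0) ->
  p0 `<=` p1.
Proof.
move=> h0 h1 p10 p0B [g0 p1g0 g0n].
have h1' := prime_ideal h1.
have [b [[p0b bn] bmin]] := @exists_minimal {poly B}
  (fun f => p0 f /\ f != 0) (fun f => size f)
  (ex_intro _ g0 (conj (p10 _ p1g0) g0n)).
have [g [[p1g gn] gmin]] := @exists_minimal {poly B}
  (fun f => p1 f /\ f != 0) (fun f => size f) (ex_intro _ g0 (conj p1g0 g0n)).
have divb f : p0 f -> exists c q, c != 0 /\ c *: f = q * b.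
  move=> p0f; exists (lead_coef b ^+ scalp f b), (f %/ b).
  split; first by rewrite expf_neq0 // lead_coef_eq0.
  have E := Pdiv.Idomain.divp_eq f b.
  rewrite E; suff -> : f %% b = 0 by rewrite addr0.
  apply/eqP; apply: contraT => rn.
  have := bmin (f %% b); rewrite leqNgt Pdiv.Idomain.ltn_modp bn; apply.
  split=> //; have -> : f %% b = (lead_coef b ^+ scalp f b)%:P * f - f %/ b * b.
    by rewrite mul_polyC E addrAC subrr add0r.
  by apply: ideal_B => //; apply: ideal_M.
have sb : (1 < size b)%N.
  rewrite ltnNge; apply/negP => /size1_polyC bE; move: p0b bn.
  by rewrite bE => /p0B ->; rewrite eqxx.
have [c [q [cn cq]]] := divb g (p10 _ p1g).
have qn : q != 0.
  apply/eqP => q0; move: cq; rewrite q0 mul0r => /eqP.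
  by rewrite -mul_polyC mulf_eq0 polyC_eq0 (negPf cn) (negPf gn).
have p1b : p1 b.
  have : p1 (q * b) by rewrite -cq -mul_polyC; apply: ideal_M.
  case/(prime_M h1) => // p1q.
  have := gmin q (conj p1q qn); rewrite -(size_scale g cn) cq.
  by rewrite size_mul // -subn1 leq_subLR addnC leqNgt ltn_add2r sb.
move=> f p0f; have [c' [q' [c'n E]]] := divb f p0f.
have : p1 (c'%:P * f) by rewrite mul_polyC E; apply: ideal_M.
case/(prime_M h1) => // /p10 /p0B c'0.
by rewrite c'0 eqxx in c'n.
Qed.

(** * Powers of a fraction with bounded denominators *)

(** Pseudo-division with an exponent that depends on a size bound only. *)
Lemma pseudo_reduce (A : idomainType) (q : {poly A}) (N : nat) (G : {poly A}) :
  q != 0 -> (size G < size q + N)%N ->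
  exists h g, lead_coef q ^+ N *: G = h * q + g /\ (size g < size q)%N.
Proof.
move=> qn; elim: N G => [|N IHN] G sG.
  by exists 0, G; rewrite mul0r add0r expr0 scale1r; split=> //; rewrite addn0 in sG.
pose t := ((size q).-1 + N)%N.
have sq : size q = (size q).-1.+1 by rewrite prednK // size_poly_gt0.
pose G' := lead_coef q *: G - G`_t *: ('X^N * q).
have sG' : (size G' < size q + N)%N.
  rewrite sq addSn ltnS; apply/leq_sizeP => j tj.
  rewrite coefB !coefZ coefXnM ltnNge (leq_trans (leq_addl _ _) tj) /=.
  move: tj; rewrite leq_eqVlt => /orP[/eqP <-|tj].
    by rewrite addnK -lead_coefE mulrC subrr.
  rewrite (nth_default _ (_ : size G <= j)%N); last first.
    by rewrite -ltnS (leq_trans sG) // addnS ltnS sq addSn.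
  rewrite (nth_default _ (_ : size q <= j - N)%N) ?mulr0 ?subrr //.
  by rewrite leq_subRL ?addnS; [rewrite sq addnS addnC | exact: leq_trans (leq_addl _ _) (ltnW tj)].
have [h [g [E sg]]] := IHN _ sG'.
exists (h + (lead_coef q ^+ N * G`_t) *: 'X^N), g; split=> //.
rewrite mulrDl addrAC -E /G' scalerBr -scalerAl !scalerA -exprSr subrK.
by [].
Qed.

(** In {poly B}, a scalar of B divides a coefficient as soon as it divides its
    product with a monic polynomial: the remainder of the division by the monic
    polynomial must vanish. *)
Lemma monic_scalar_regular (B : idomainType) (s : B) (beta f g : {poly B}) :
  beta \is monic -> s != 0 -> s%:P * f = beta * g -> exists w, g = s%:P * w.
Proof.
move=> bm sn E; exists (f %/ beta).
have fE := Pdiv.IdomainMonic.divp_eq bm f.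
have E' : beta * (g - s%:P * (f %/ beta)) = s *: (f %% beta).
  rewrite mulrBr -E {1}fE -mul_polyC; ring.
apply/eqP; rewrite -subr_eq0; apply: contraT => dn.
have := congr1 (size \o polyseq) E' => /=.
rewrite size_monicM // size_scale // => sE.
have := Pdiv.Idomain.ltn_modp f beta; rewrite -sE (monic_neq0 bm).
case: (size _) (size_poly_gt0 (g - s%:P * (f %/ beta))) => [|m]; first by rewrite dn.
by move=> _; rewrite addnS /= ltnNge leq_addr.
Qed.

(** Think of the fraction h = u1 / r = u2 / beta: one and the same c turns every
    h^j into an element c h^j of K. Indeed a common denominator c brings all
    u1^j and u2^j into the module spanned over {poly B} by the powers of u1
    below the degree of a minimal equation. This module is free, so r^j can be
    cancelled coefficientwise in r^j (c u2^j) = beta^j (c u1^j). *)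
Lemma bounded_denominator (B : idomainType) (K : comNzRingType)
    (theta : {rmorphism {poly B} -> K}) (r : B) (beta : {poly B}) (u1 u2 : K) :
  (forall a, theta a = 0 -> a = 0) -> r != 0 -> beta \is monic ->
  integralOver theta u1 -> integralOver theta u2 ->
  theta r%:P * u2 = theta beta * u1 ->
  exists2 c, c != 0 & forall j, exists v, theta c * u1 ^+ j = theta r%:P ^+ j * v.
Proof.
move=> inj rn bm [p1 p1m /rootP hp1] [p2 p2m /rootP hp2] E.
pose ev (G : {poly {poly B}}) := (map_poly theta G).[u1].
have evD G H : ev (G + H) = ev G + ev H by rewrite /ev rmorphD hornerD.
have evB G H : ev (G - H) = ev G - ev H by rewrite /ev rmorphB hornerD hornerN.
have evM G H : ev (G * H) = ev G * ev H by rewrite /ev rmorphM hornerM.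
have evZ a G : ev (a *: G) = theta a * ev G.
  by rewrite -mul_polyC evM /ev map_polyC hornerC.
have evXn n : ev ('X^n) = u1 ^+ n by rewrite /ev map_polyXn hornerXn.
have [q [[evq qn] qmin]] := @exists_minimal {poly {poly B}}
  (fun G => ev G = 0 /\ G != 0) (fun G => size G)
  (ex_intro _ p1 (conj hp1 (monic_neq0 p1m))).
have free G : ev G = 0 -> (size G < size q)%N -> G = 0.
  move=> evG sG; apply/eqP; apply: contraT => Gn.
  by have := qmin G (conj evG Gn); rewrite leqNgt sG.
set l := lead_coef q; set N1 := size p1; set N2 := size p2.
have ln : l != 0 by rewrite lead_coef_eq0.
have sq : (0 < size q)%N by rewrite size_poly_gt0.
have red N (G : {poly {poly B}}) : (size G <= N)%N ->
    exists2 g : {poly {poly B}}, (size g < size q)%N & theta (l ^+ N) * ev G = ev g.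
  move=> sG; have [|h [g [Eg sg]]] := @pseudo_reduce _ q N G qn.
    by rewrite (leq_ltn_trans sG) // -[X in (X < _)%N]add0n ltn_add2r.
  by exists g => //; rewrite -evZ Eg evD evM evq mulr0 add0r.
have red1 j : exists2 g : {poly {poly B}}, (size g < size q)%N & theta (l ^+ N1) * u1 ^+ j = ev g.
  have := Pdiv.RingMonic.rdivp_eq p1m 'X^j.
  set h := Pdiv.Ring.rdivp _ _; set rho := Pdiv.Ring.rmodp _ _ => Ej.
  have srho : (size rho <= N1)%N.
    by rewrite ltnW // Pdiv.Ring.ltn_rmodp monic_neq0.
  have [g sg Eg] := red _ _ srho; exists g => //.
  by rewrite -Eg -evXn Ej evD evM [ev p1]hp1 mulr0 add0r.
have red2 j : exists2 g : {poly {poly B}}, (size g < size q)%N &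
    theta (l ^+ N2 * r%:P ^+ N2) * u2 ^+ j = ev g.
  have := Pdiv.RingMonic.rdivp_eq p2m 'X^j.
  set h := Pdiv.Ring.rdivp _ _; set rho := Pdiv.Ring.rmodp _ _ => Ej.
  have srho : (size rho < N2)%N by rewrite Pdiv.Ring.ltn_rmodp monic_neq0.
  pose G := \poly_(i < N2) (rho`_i * (r%:P ^+ (N2 - i) * beta ^+ i)).
  have [g sg Eg] := red _ _ (size_poly _ _ : (size G <= N2)%N); exists g => //.
  rewrite -Eg rmorphM -mulrA; congr (_ * _).
  have -> : u2 ^+ j = (map_poly theta rho).[u2].
    have := congr1 (fun G => (map_poly theta G).[u2]) Ej.
    by rewrite /= map_polyXn hornerXn rmorphD rmorphM hornerD hornerM hp2 mulr0 add0r.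
  rewrite (@horner_coef_wide _ N2); last first.
    by rewrite (leq_trans (size_poly _ _)) // ltnW.
  rewrite /ev (@horner_coef_wide _ N2); last first.
    by rewrite (leq_trans (size_poly _ _)) // size_poly.
  rewrite mulr_sumr; apply: eq_bigr => i _.
  rewrite !coef_map coef_poly ltn_ord /= !rmorphM !rmorphXn /=.
  have -> : theta r%:P ^+ N2 = theta r%:P ^+ (N2 - i) * theta r%:P ^+ i.
    by rewrite -exprD subnK // ltnW.
  have -> : theta r%:P ^+ (N2 - i) * theta r%:P ^+ i * (theta rho`_i * u2 ^+ i)
    = theta r%:P ^+ (N2 - i) * theta rho`_i * (theta r%:P ^+ i * u2 ^+ i) by ring.
  have -> : theta r%:P ^+ i * u2 ^+ i = theta beta ^+ i * u1 ^+ i.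
    by rewrite -!exprMn E.
  ring.
pose c := l ^+ N1 * (l ^+ N2 * r%:P ^+ N2).
exists c; first by rewrite /c !mulf_neq0 ?expf_neq0 ?polyC_eq0.
move=> j; have [g1 sg1 E1] := red1 j; have [g2 sg2 E2] := red2 j.
pose h1 := (l ^+ N2 * r%:P ^+ N2) *: g1; pose h2 := l ^+ N1 *: g2.
have Eh1 : theta c * u1 ^+ j = ev h1 by rewrite evZ -E1 /c !rmorphM /=; ring.
have Eh2 : theta c * u2 ^+ j = ev h2 by rewrite evZ -E2 /c !rmorphM /=; ring.
have sh (a : {poly B}) (g : {poly {poly B}}) :
    (size g < size q)%N -> (size (a *: g) < size q)%N.
  by apply: leq_ltn_trans; apply: size_scale_leq.
have sh1 := sh (l ^+ N2 * r%:P ^+ N2) _ sg1.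
have sh2 := sh (l ^+ N1) _ sg2.
have Eh : r%:P ^+ j *: h2 = beta ^+ j *: h1.
  apply/eqP; rewrite -subr_eq0; apply/eqP/free.
    rewrite evB (evZ _ h2) (evZ _ h1) -Eh1 -Eh2 !rmorphXn /= mulrCA -exprMn E exprMn.
    by rewrite [X in _ - X]mulrCA subrr.
  rewrite (leq_ltn_trans (size_polyD _ _)) // size_polyN gtn_max.
  by rewrite !sh.
have div i : exists w, h1`_i = (r ^+ j)%:P * w.
  apply: (@monic_scalar_regular _ _ (beta ^+ j) h2`_i); first exact: monic_exp.
    by rewrite expf_neq0.
  have := congr1 (fun f : {poly {poly B}} => f`_i) Eh.
  by rewrite /= !coefZ rmorphXn.
have [w hw] := choice div.
exists (ev (\poly_(i < size h1) w i)).
rewrite Eh1 -rmorphXn -evZ; congr ev; apply/polyP => i.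
rewrite coefZ coef_poly -rmorphXn; case: ltnP => [_|hi]; first exact: hw.
by rewrite mulr0 nth_default.
Qed.

(** * Polynomials as functions over an algebraically closed field *)

Lemma poly_eq0_on_units (C : closedFieldType) (p : {poly C}) :
  (forall l, l != 0 -> p.[l] = 0) -> p = 0.
Proof.
move=> h; apply/eqP; apply: contraT => pn.
have /closed_nonrootP[x] : 'X * p != 0 by rewrite mulf_neq0 ?polyX_eq0.
rewrite rootE hornerM hornerX; have [->|xn] := eqVneq x 0.
  by rewrite mul0r eqxx.
by rewrite h // mulr0 eqxx.
Qed.

Lemma muni_meval (C : comNzRingType) (m : nat) (f : {mpoly C[m.+1]})
    (v : 'I_m.+1 -> C) :
  f.@[v] = (map_poly (meval (fun i => v (widen_ord (leqnSn m) i))) (muni f)).[v ord_max].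
Proof.
rewrite muniE mevalE rmorph_sum /= horner_sum; apply: eq_bigr => k _.
rewrite -!mul_polyC !rmorphM /= map_polyC map_polyXn /= -mul_mpolyC rmorphM /= mevalC mevalX !hornerE.
rewrite big_ord_recr /=.
rewrite mulrA; congr (_ * _ * _); apply: eq_bigr => i _.
by rewrite mnmE.
Qed.

Lemma muni_eq0 (C : comNzRingType) (m : nat) (f : {mpoly C[m.+1]}) :
  muni f = 0 -> f = 0.
Proof.
move=> f0; apply/mpolyP => k; rewrite mcoeff0.
pose k' : 'X_{1..m} := [multinom k (widen_ord (leqnSn m) i) | i < m].
have := congr1 (fun g : {poly {mpoly C[m]}} => (g`_(k ord_max))@_k') f0.
rewrite coef0 mcoeff0 muniE coef_sum raddf_sum /=.
have [kf|] := boolP (k \in msupp f); last by move/memN_msupp_eq0.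
rewrite (bigD1_seq k) //= ?msupp_uniq // big1 ?addr0.
  by rewrite coefZ coefXn eqxx mulr1 mcoeffZ mcoeffX eqxx mulr1.
move=> j jk; rewrite coefZ coefXn; case: eqP => [Ej|_]; last by rewrite mulr0 mcoeff0.
rewrite mulr1 mcoeffZ mcoeffX; case: eqP => [Ej'|_]; last by rewrite mulr0.
case/eqP: jk; apply/mnmP => i; case: (unliftP ord_max i) => [i' ->|-> //].
move/mnmP: Ej' => /(_ i'); rewrite !mnmE.
suff -> : widen_ord (leqnSn m) i' = lift ord_max i' by [].
by apply: val_inj; rewrite /= /bump leqNgt ltn_ord.
Qed.

Lemma mpoly_neq0_point (C : closedFieldType) (m : nat) (f : {mpoly C[m]}) :
  f != 0 -> exists v, f.@[v] != 0.
Proof.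
elim: m f => [|m IHm] f fn.
  exists (fun=> 0); apply: contra fn => /eqP f0.
  have fC : f = (f@_0%MM)%:MP.
    apply/mpolyP => k; rewrite mcoeffC.
    have -> : k = 0%MM by apply/mnmP => -[].
    by rewrite eqxx mulr1.
  by rewrite fC mevalC in f0; rewrite fC f0.
have /eqP lc0 : lead_coef (muni f) != 0.
  by rewrite lead_coef_eq0; apply: contra fn => /eqP /muni_eq0 ->.
have [v vn] := IHm _ (introN eqP lc0).
have : map_poly (meval v) (muni f) != 0.
  apply: contraNneq vn => h.
  by rewrite lead_coefE -coef_map h coef0.
case/closed_nonrootP => x xn.
exists (fun i => if unlift ord_max i is Some j then v j else x).
rewrite muni_meval unlift_none; apply: contraNneq xn => h.
apply/rootP; rewrite -[RHS]h; congr (_.[_]); apply: eq_map_poly => g.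
apply: meval_eq => i.
have -> : widen_ord (leqnSn m) i = lift ord_max i.
  by apply: val_inj; rewrite /= /bump leqNgt ltn_ord.
by rewrite liftK.
Qed.

(** * Restriction of a polynomial to a line through the origin *)

Section ConePoly.
Variables (C : closedFieldType) (N : nat).
Implicit Types (p : 'I_N -> C) (f g : {mpoly C[N]}).

Definition cone_poly p f : {poly C} :=
  mmap (@polyC C) (fun i => (p i)%:P * 'X) f.

Lemma cone_polyM p f g : cone_poly p (f * g) = cone_poly p f * cone_poly p g.
Proof. exact: rmorphM. Qed.

Lemma cone_polyB p f g : cone_poly p (f - g) = cone_poly p f - cone_poly p g.
Proof. exact: rmorphB. Qed.

Lemma cone_polyXn p f j : cone_poly p (f ^+ j) = cone_poly p f ^+ j.
Proof. exact: rmorphXn. Qed.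

Lemma cone_polyE p f :
  cone_poly p f = \sum_(k <- msupp f) (f@_k * \prod_i p i ^+ k i)%:P * 'X^(mdeg k).
Proof.
apply: eq_bigr => k _; rewrite polyCM -mulrA; congr (_ * _).
rewrite /mmap1 mdegE -prodrXr rmorph_prod -big_split /=.
by apply: eq_bigr => i _; rewrite exprMn rmorphXn.
Qed.

Lemma coef_cone_poly p f d : (cone_poly p f)`_d = (pihomog mdeg d f).@[p].
Proof.
rewrite cone_polyE pihomogE coef_sum rmorph_sum /= [RHS]big_mkcond /=.
apply: eq_bigr => k _; rewrite coefCM coefXn eq_sym.
case: eqP => _; last by rewrite mulr0.
by rewrite mulr1 mevalZ mevalX.
Qed.

Lemma horner_cone_poly p f l : (cone_poly p f).[l] = f.@[fun i => l * p i].
Proof.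
rewrite cone_polyE mevalE horner_sum; apply: eq_bigr => k _.
rewrite !hornerE -mulrA; congr (_ * _).
rewrite mdegE -prodrXr -big_split /=.
by apply: eq_bigr => i _; rewrite exprMn mulrC.
Qed.

Lemma cone_poly_homog p f d : f \is d.-homog ->
  cone_poly p f = (f.@[p])%:P * 'X^d.
Proof.
move=> fd; apply/polyP => e; rewrite coef_cone_poly coefCM coefXn.
have [->|ed] := eqVneq e d; first by rewrite pihomog_dE // mulr1.
by rewrite (pihomog_ne0 _ fd) ?meval0 ?mulr0 // eq_sym.
Qed.

Lemma meval_homog p f d l : f \is d.-homog ->
  f.@[fun i => l * p i] = l ^+ d * f.@[p].
Proof.
by move=> fd; rewrite -horner_cone_poly (cone_poly_homog _ fd) !hornerE mulrC.
Qed.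

Lemma pihomog_mul_homog f g d e : g \is d.-homog ->
  pihomog mdeg e (f * g) = if (d <= e)%N then pihomog mdeg (e - d) f * g else 0.
Proof.
move=> gd; pose k := msize f.
have fE := pihomog_partitionE (mf := mdeg) (leqnn (msize f)).
rewrite {1}fE mulr_suml raddf_sum /=.
have hd i : pihomog mdeg i f * g \is (i + d).-homog by rewrite dhomogM // pihomogP.
have small i : (msize f <= i)%N -> pihomog mdeg i f = 0.
  move=> hi; rewrite pihomogE big_seq_cond big1 // => j /andP[jf /eqP ji].
  by have := msize_mdeg_lt jf; rewrite ji ltnNge hi.
have [de|ed] := leqP d e; last first.
  rewrite big1 // => i _; rewrite (pihomog_ne0 _ (hd i)) //.
  by rewrite gtn_eqF // ltn_addl.
have [lt|ge] := ltnP (e - d) (msize f).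
  rewrite (bigD1 (Ordinal lt)) //= big1 ?addr0.
    by rewrite pihomog_dE // -[X in X.-homog](subnK de).
  move=> i ni; rewrite (pihomog_ne0 _ (hd i)) //.
  apply: contra ni => /eqP ie; apply/eqP/val_inj => /=.
  by rewrite -ie addnK.
rewrite small // mul0r big1 // => i _; rewrite (pihomog_ne0 _ (hd i)) //.
apply: contraTneq (ltn_ord i) => ie; rewrite -leqNgt.
by rewrite (leq_trans ge) // -ie addnK.
Qed.
End ConePoly.

(** * Vanishing ideals of cones *)

Section Vanishing.
Variables (C : closedFieldType) (n : nat).
Implicit Types (p : coords C n) (f g : {mpoly C[n.+1]}) (Z : set (coords C n)).

Definition scale_pt (l : C) p : coords C n := fun i => l * p i.

Lemma scale_pt1 p : scale_pt 1 p = p.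
Proof. by apply/funext => i; rewrite /scale_pt mul1r. Qed.

Definition vanishing Z : set {mpoly C[n.+1]} :=
  [set f | forall p, Z p -> f.@[p] = 0].

Definition is_cone Z := forall p l, l != 0 -> Z p -> Z (scale_pt l p).

(** Ideals closed under this relation are the homogeneous ones. *)
Definition component_of f g := exists d, g = pihomog mdeg d f.

Lemma vanishing_ideal Z : is_ideal (vanishing Z).
Proof.
split=> [p Zp|f g hf hg p Zp|a f hf p Zp].
- by rewrite meval0.
- by rewrite mevalD hf // hg // addr0.
- by rewrite mevalM hf // mulr0.
Qed.

Lemma sub_vanishing Y Z : Y `<=` Z -> vanishing Z `<=` vanishing Y.
Proof. by move=> YZ f hf p /YZ /hf. Qed.

Lemma zclosed_cone Z : zclosed Z -> is_cone Z.
Proof.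
move=> [F [Fh ->]] p l l0 [[i pi] hp]; split.
  by exists i; rewrite mulf_neq0.
by move=> f Ff; have [d fd] := Fh _ Ff; rewrite (meval_homog _ _ fd) hp ?mulr0.
Qed.

Lemma vanishing_cone_poly Z f p : is_cone Z -> vanishing Z f -> Z p ->
  cone_poly p f = 0.
Proof.
move=> Zc hf Zp; apply: poly_eq0_on_units => l l0.
by rewrite horner_cone_poly; apply: hf; apply: Zc.
Qed.

Lemma vanishing_components Z : is_cone Z -> closed_under component_of (vanishing Z).
Proof.
move=> Zc f _ hf [d ->] p Zp.
by rewrite -coef_cone_poly (vanishing_cone_poly Zc) ?coef0.
Qed.

Lemma zclosed_sub Y Z : zclosed Z -> (Y `<=` @projective_space C n) ->
  vanishing Z `<=` vanishing Y -> Y `<=` Z.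
Proof.
move=> [F [Fh ->]] Ypr YZ p Yp; split; first exact: Ypr.
by move=> f Ff; apply: (YZ f) => // q [_ /(_ _ Ff)].
Qed.

Lemma zclosed_proj Z : zclosed Z -> Z `<=` @projective_space C n.
Proof. by move=> [F [_ ->]] p []. Qed.

Lemma zclosed_cone_locus f :
  zclosed [set p | @projective_space C n p /\ cone_poly p f = 0].
Proof.
exists (component_of f); split=> [_ [d ->]|]; first by exists d; exact: pihomogP.
apply/seteqP; split=> p [pr hp]; split=> //.
  by move=> _ [d ->]; rewrite -coef_cone_poly hp coef0.
apply/polyP => d; rewrite coef_cone_poly coef0; apply: hp.
by exists d.
Qed.

(** On the line through p a product of polynomials vanishes only if a factor
    does, so Z is the union of two closed sets as soon as f g vanishes on Z. *)
Lemma vanishing_prime Z : irreducible_closed Z -> is_prime_ideal (vanishing Z).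
Proof.
move=> [Zcl [p0 Zp0] Zirr]; split.
- exact: vanishing_ideal.
- by move=> /(_ p0 Zp0) /eqP; rewrite meval1 oner_eq0.
move=> f g hfg.
have Zc := zclosed_cone Zcl.
have [|h|h] := Zirr _ _ (zclosed_cone_locus f) (zclosed_cone_locus g).
- move=> p Zp; have pr := zclosed_proj Zcl Zp.
  have /eqP := vanishing_cone_poly Zc hfg Zp.
  by rewrite cone_polyM mulf_eq0 => /orP[] /eqP; [left|right].
- left=> p Zp; have [_ fp] := h p Zp.
  by rewrite -(scale_pt1 p) -horner_cone_poly fp horner0.
- right=> p Zp; have [_ gp] := h p Zp.
  by rewrite -(scale_pt1 p) -horner_cone_poly gp horner0.
Qed.
End Vanishing.

(** * Noether normalization *)

Lemma mcoeff_pihomog (C : nzRingType) (N : nat) (f : {mpoly C[N]}) d k :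
  (pihomog mdeg d f)@_k = if mdeg k == d then f@_k else 0.
Proof.
rewrite pihomogE raddf_sum /= big_mkcond /=.
have [kf|kf] := boolP (k \in msupp f); last first.
  rewrite (memN_msupp_eq0 kf) if_same big_seq big1 // => j jf.
  case: eqP => // _; rewrite mcoeffZ mcoeffX; case: eqP => [jk|_]; last by rewrite mulr0.
  by rewrite jk (negPf kf) in jf.
rewrite (bigD1_seq k) //= ?msupp_uniq // big1 ?addr0.
  by case: eqP => // _; rewrite mcoeffZ mcoeffX eqxx mulr1.
move=> j jk; case: eqP => // _.
by rewrite mcoeffZ mcoeffX (negPf jk) mulr0.
Qed.

Lemma top_component_neq0 (C : nzRingType) (N : nat) (f : {mpoly C[N]}) :
  f != 0 -> pihomog mdeg (msize f).-1 f != 0.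
Proof.
apply: contraNneq => h; apply/eqP.
have [//|fn] := eqVneq f 0.
have := congr1 (mcoeff (mlead f)) h.
rewrite mcoeff_pihomog mcoeff0 -mlead_deg // eqxx => /eqP.
by rewrite mleadc_eq0 => /eqP.
Qed.

Section ExtSubst.
Variables (C : comNzRingType) (m N : nat).

Definition ext_subst (l : m.-tuple {mpoly C[N]}) (z : {mpoly C[N]})
    (g : {poly {mpoly C[m]}}) : {mpoly C[N]} :=
  (map_poly (comp_mpoly l) g).[z].

HB.instance Definition _ l z := GRing.RMorphism.copy (ext_subst l z)
  (horner_eval z \o map_poly (comp_mpoly l)).

Lemma ext_substC l z a : ext_subst l z a%:P = a \mPo l.
Proof. by rewrite /ext_subst map_polyC hornerC. Qed.

Lemma ext_substX l z : ext_subst l z 'X = z.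
Proof. by rewrite /ext_subst map_polyX hornerX. Qed.

End ExtSubst.

Lemma comp_mpoly_var (C : comNzRingType) (m N : nat) (l : m.-tuple {mpoly C[N]}) i :
  'X_i \mPo l = tnth l i.
Proof. by rewrite comp_mpolyXU (tnth_nth 0). Qed.

Lemma mpoly_rmorph_ext (C K : comNzRingType) (m : nat)
    (phi psi : {rmorphism {mpoly C[m]} -> K}) :
  (forall c, phi c%:MP = psi c%:MP) -> (forall i, phi 'X_i = psi 'X_i) ->
  phi =1 psi.
Proof.
move=> hC hX f; rewrite [f]mpolyE !rmorph_sum; apply: eq_bigr => k _.
rewrite -mul_mpolyC !rmorphM /= hC mpolyXE_id !rmorph_prod; congr (_ * _).
by apply: eq_bigr => i _; rewrite !rmorphXn /= hX.
Qed.

Lemma poly_mpoly_rmorph_ext (C K : comNzRingType) (m : nat)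
    (phi psi : {rmorphism {poly {mpoly C[m]}} -> K}) :
  (forall c, phi (c%:MP)%:P = psi (c%:MP)%:P) ->
  (forall i, phi ('X_i)%:P = psi ('X_i)%:P) -> phi 'X = psi 'X ->
  phi =1 psi.
Proof.
move=> hC hX hX' g; rewrite -[g]coefK poly_def !rmorph_sum; apply: eq_bigr => k _.
rewrite -mul_polyC !rmorphM /= !rmorphXn /= hX'; congr (_ * _).
exact: (mpoly_rmorph_ext (phi := phi \o polyC) (psi := psi \o polyC)).
Qed.

Section Shear.
Variables (C : closedFieldType) (m : nat).
Implicit Types (c : 'I_m -> C).

Let img c (j : 'I_m.+1) : {poly {mpoly C[m]}} :=
  if unlift ord_max j is Some i then ('X_(i : 'I_m))%:P + (c i)%:MP%:P * 'X
  else 'X.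

Definition shear_poly c : {mpoly C[m.+1]} -> {poly {mpoly C[m]}} :=
  mmap (@polyC {mpoly C[m]} \o @mpolyC m C) (img c).

HB.instance Definition _ c := GRing.RMorphism.copy (shear_poly c)
  (mmap (@polyC {mpoly C[m]} \o @mpolyC m C) (img c)).

Definition shear N c (l : m.+1.-tuple {mpoly C[N]}) : m.-tuple {mpoly C[N]} :=
  [tuple tnth l (lift ord_max i) - c i *: tnth l ord_max | i < m].

Lemma shear_polyC c a : shear_poly c a%:MP = a%:MP%:P.
Proof. exact: mmapC. Qed.

Lemma shear_polyX c j : shear_poly c 'X_j = img c j.
Proof. by rewrite /shear_poly mmapX mmap1U. Qed.

Lemma shear_polyP N c (l : m.+1.-tuple {mpoly C[N]}) f :
  ext_subst (shear c l) (tnth l ord_max) (shear_poly c f) = f \mPo l.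
Proof.
apply: (mpoly_rmorph_ext (psi := comp_mpoly l)
  (phi := ext_subst (shear c l) (tnth l ord_max) \o shear_poly c)) => [a|j] /=.
  by rewrite shear_polyC ext_substC !comp_mpolyC.
rewrite shear_polyX comp_mpoly_var /img; case: unliftP => [i ->|->]; last first.
  by rewrite ext_substX.
rewrite rmorphD rmorphM /= !ext_substC ext_substX comp_mpolyC comp_mpoly_var.
by rewrite tnth_mktuple mul_mpolyC subrK.
Qed.

Definition unshear c : {poly {mpoly C[m]}} -> {mpoly C[m.+1]} :=
  let l := [tuple 'X_j | j < m.+1] in ext_subst (shear c l) (tnth l ord_max).

Lemma unshearP N c (l : m.+1.-tuple {mpoly C[N]}) g :
  unshear c g \mPo l = ext_subst (shear c l) (tnth l ord_max) g.
Proof.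
rewrite /unshear; set l0 := [tuple _ | _ < _].
apply: (poly_mpoly_rmorph_ext
  (phi := comp_mpoly l \o ext_subst (shear c l0) (tnth l0 ord_max))
  (psi := ext_subst (shear c l) (tnth l ord_max))) => [a|i|] /=.
- by rewrite !ext_substC !comp_mpolyC.
- rewrite !ext_substC !comp_mpoly_var !tnth_mktuple rmorphB /= comp_mpolyZ.
  by rewrite !comp_mpoly_var.
- by rewrite !ext_substX tnth_mktuple comp_mpoly_var.
Qed.

Lemma shear_polyK c g : shear_poly c (unshear c g) = g.
Proof.
rewrite /unshear; set l0 := [tuple _ | _ < _].
apply: (poly_mpoly_rmorph_ext
  (phi := shear_poly c \o ext_subst (shear c l0) (tnth l0 ord_max))
  (psi := idfun)) => [a|i|] /=.
- by rewrite ext_substC comp_mpolyC shear_polyC.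
- rewrite ext_substC comp_mpoly_var !tnth_mktuple rmorphB /= -mul_mpolyC.
  rewrite rmorphM /= shear_polyC !shear_polyX /img unlift_none liftK.
  by rewrite addrK.
- by rewrite ext_substX tnth_mktuple shear_polyX /img unlift_none.
Qed.

Let deg_top (R : nzRingType) d (a : R) (p : {poly R}) := (size p <= d.+1)%N /\ p`_d = a.

Let deg_topM (R : nzRingType) d e (a b : R) p q : deg_top d a p -> deg_top e b q ->
  deg_top (d + e)%N (a * b) (p * q).
Proof.
move=> [sp <-] [sq <-]; split.
  rewrite (leq_trans (size_polyMleq _ _)) // -subn1 leq_subLR.
  by rewrite (leq_trans (leq_add sp sq)) // addSn addnS add1n.
rewrite coefM (bigD1 (inord d)) //= inordK ?ltnS ?leq_addr // addKn big1 ?addr0 //.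
move=> i id; have [lt|le] := ltnP d i.
  by rewrite (nth_default _ (leq_trans sp lt)) mul0r.
rewrite (nth_default 0 (s := q)) ?mulr0 // (leq_trans sq) //.
rewrite ltn_subRL ltn_add2r ltn_neqAle le andbT.
apply: contra id => /eqP id; apply/eqP/val_inj.
by rewrite /= inordK ?ltnS ?leq_addr.
Qed.

Lemma shear_poly_top c f :
  (size (shear_poly c f) <= msize f)%N /\
  (shear_poly c f)`_(msize f).-1 = (pihomog mdeg (msize f).-1 f).@[
    fun j => if unlift ord_max j is Some i then c i else 1]%:MP.
Proof.
set v := fun j : 'I_m.+1 => _.
have deg_topX (k : 'X_{1..m.+1}) :
    deg_top (mdeg k) (\prod_j v j ^+ k j)%:MP (shear_poly c 'X_[k]).
  rewrite mpolyXE_id !rmorph_prod mdegE /=.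
  elim/big_ind3: _ => [|d a p e b q|j _].
  - by split; rewrite ?size_poly1 // coef1.
  - exact: deg_topM.
  - rewrite !rmorphXn /= shear_polyX.
    have deg_top1 : deg_top 1 (v j)%:MP (img c j).
      rewrite /v /img; case: (unlift _ _) => [i|]; last by split; rewrite ?size_polyX ?coefX.
      split; last by rewrite coefD coefC coefMX coefC add0r.
      rewrite (leq_trans (size_polyD _ _)) // geq_max (leq_trans (size_polyC_leq1 _)) //.
      rewrite (leq_trans (size_polyMleq _ _)) // size_polyX addn2 /=.
      by rewrite ltnS size_polyC_leq1.
    elim: (k j) => [|d IHd]; first by split; rewrite ?size_poly1 ?coef1 ?expr0.
    by rewrite !exprS; exact: (deg_topM (d := 1) deg_top1 IHd).
have E : shear_poly c f = \sum_(k <- msupp f) (f@_k)%:MP%:P * shear_poly c 'X_[k].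
  rewrite {1}[f]mpolyE rmorph_sum; apply: eq_bigr => k _.
  by rewrite -mul_mpolyC rmorphM /= shear_polyC.
split.
  rewrite E (leq_trans (size_sum _ _ _)) //.
  apply/bigmax_leqP_seq => k kf _; rewrite (leq_trans (size_polyMleq _ _)) //.
  case: (deg_topX k) => hk _.
  have := msize_mdeg_lt kf; apply: leq_trans.
  rewrite -subn1 leq_subLR (leq_trans (leq_add (size_polyC_leq1 _) hk)) //.
rewrite E coef_sum pihomogE (rmorph_sum (meval _)) /= (rmorph_sum (@mpolyC m C)) /=.
rewrite [RHS]big_mkcond big_seq [RHS]big_seq; apply: eq_bigr => k kf.
rewrite coefCM; case: (deg_topX k) => hk hk'; case: eqP => [<-|kd].
  by rewrite hk' mevalZ mevalX mpolyCM.
rewrite nth_default ?mulr0 // (leq_trans hk) //.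
have := msize_mdeg_lt kf.
move: kd; case: (msize f) => [|d] //= kd; rewrite ltnS leq_eqVlt => /orP[/eqP|//].
by move=> h; case: kd.
Qed.

(** The leading coefficient of a sheared polynomial is the value of its top
    component at (c, 1), which is not zero for generic c. The factor 'X_ord_max
    makes sure that the last coordinate of the point found can be scaled to 1. *)
Lemma exists_monic_shear (b : {mpoly C[m.+1]}) : b != 0 ->
  exists c beta a, beta \is monic /\
    beta = shear_poly c (a *: ('X_ord_max * b)).
Proof.
move=> bn; pose f := 'X_ord_max * b.
have Xn : 'X_ord_max != 0 :> {mpoly C[m.+1]} by rewrite -msize_poly_eq0 msizeX.
have fn : f != 0 by rewrite mulf_neq0.
set d := (msize f).-1.
have := top_component_neq0 fn; rewrite -/d => gn.
have [v] := mpoly_neq0_point (mulf_neq0 Xn gn).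
rewrite mevalM mevalXU mulf_eq0 negb_or => /andP[vn gv].
pose c i := (v ord_max)^-1 * v (lift ord_max i).
have [sf cf] := shear_poly_top c f.
set w := fun j : 'I_m.+1 => _ in cf.
have wE : w =1 (fun j => (v ord_max)^-1 * v j).
  by move=> j; rewrite /w; case: unliftP => [i ->|->]; rewrite ?mulVf.
rewrite -/d (meval_eq _ wE) (meval_homog _ _ (pihomogP _ _ _)) in cf.
set t := _ * _ in cf.
have tn : t != 0 by rewrite mulf_neq0 // expf_neq0 // invr_eq0.
exists c, (shear_poly c (t^-1 *: f)), t^-1; split=> //.
have E : shear_poly c (t^-1 *: f) = (t^-1)%:MP *: shear_poly c f.
  by rewrite -mul_mpolyC rmorphM /= shear_polyC mul_polyC.
rewrite E monicE lead_coefZ.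
have -> : lead_coef (shear_poly c f) = t%:MP.
  rewrite lead_coefE -cf; congr (_`_(_.-1)); apply/eqP; rewrite eqn_leq sf /=.
  have sfn : (0 < msize f)%N by rewrite lt0n msize_poly_eq0.
  rewrite -(prednK sfn) ltnNge; apply/negP => /leq_sizeP /(_ _ (leqnn _)).
  by rewrite cf => /eqP; rewrite mpolyC_eq0 (negPf tn).
by rewrite -mpolyCM mulVf.
Qed.
End Shear.

Section Normalization.
Variables (C : closedFieldType) (N : nat).
Implicit Types (I : set {mpoly C[N]}).

Definition finite_over (K : comNzRingType) (theta : K -> {mpoly C[N]}) I :=
  forall f, integral_mod theta I f.

Lemma finite_over_ext I m (l : m.-tuple {mpoly C[N]}) z (beta : {poly {mpoly C[m]}}) :
  is_ideal I -> finite_over (ext_subst l z) I -> beta \is monic ->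
  I (ext_subst l z beta) -> finite_over (comp_mpoly l) I.
Proof.
move=> hI fin bm Ib f; apply: (integral_mod_trans hI _ (fin f)) => g.
have int_z : integral_mod (comp_mpoly l) I z by exists beta.
change (integral_mod (comp_mpoly l) I (map_poly (comp_mpoly l) g).[z]).
rewrite horner_coef; apply: big_ind => [|x y|i _].
- by rewrite -(rmorph0 (comp_mpoly l)); apply: integral_mod_id.
- exact: integral_mod_D.
rewrite coef_map; apply: integral_mod_M => //; first exact: integral_mod_id.
elim: (i : nat) => [|j IHj]; last by rewrite exprS; apply: integral_mod_M.
by rewrite expr0 -(rmorph1 (comp_mpoly l)); apply: integral_mod_id.
Qed.

Lemma finite_over_shear I m (l : m.+1.-tuple {mpoly C[N]}) c :
  is_ideal I -> finite_over (comp_mpoly l) I ->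
  finite_over (ext_subst (shear c l) (tnth l ord_max)) I.
Proof.
move=> hI fin f; apply: (integral_mod_trans hI _ (fin f)) => g.
by rewrite /= -(shear_polyP c); apply: integral_mod_id.
Qed.

Lemma mpoly0_const (f : {mpoly C[0]}) : f = (f@_0%MM)%:MP.
Proof.
apply/mpolyP => k; rewrite mcoeffC.
have -> : k = 0%MM by apply/mnmP => -[].
by rewrite eqxx mulr1.
Qed.

Lemma ideal_mpolyC I (a : C) : is_ideal I -> a != 0 -> I a%:MP -> I 1.
Proof.
by move=> hI an /(ideal_M hI a^-1%:MP); rewrite -mpolyCM mulVf.
Qed.

(** A polynomial relation between the generators l can be made monic by a shear,
    and one generator becomes superfluous; so a least number of generators are
    algebraically independent. *)
Lemma noether_normalization I : is_ideal I -> ~ I 1 ->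
  exists m (l : m.-tuple {mpoly C[N]}), finite_over (comp_mpoly l) I /\
    (forall f : {mpoly C[m]}, I (f \mPo l) -> f = 0).
Proof.
move=> hI I1.
have [|[m l] [fin min]] := @exists_minimal {m : nat & m.-tuple {mpoly C[N]}}
  (fun ml => finite_over (comp_mpoly (projT2 ml)) I) (fun ml => projT1 ml).
  exists (existT _ N [tuple 'X_i | i < N]) => f /=.
  rewrite -[f]comp_mpoly_id; exact: (integral_mod_id (comp_mpoly [tuple 'X_i | i < N])).
exists m, l; split=> // f If; apply/eqP; apply: contraT => fn.
case: m l fin min f If fn => [|m] l fin min f If fn.
  case: I1; apply: (@ideal_mpolyC I f@_0%MM) => //.
    by apply: contra fn => /eqP f0; rewrite (mpoly0_const f) f0.
  by move: If; rewrite {1}(mpoly0_const f) comp_mpolyC.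
have [c [beta [a [bm bE]]]] := exists_monic_shear fn.
suff fin' : finite_over (comp_mpoly (shear c l)) I.
  by have := min (existT _ m (shear c l)) fin'; rewrite /= ltnn.
apply: (finite_over_ext hI (finite_over_shear c hI fin) bm).
rewrite bE shear_polyP comp_mpolyZ -mul_mpolyC rmorphM /=.
by apply: (ideal_M hI); apply: (ideal_M hI).
Qed.

(** The normalization relative to a larger ideal D: beside independence of the
    generators modulo I, the last generator is integral over the others modulo
    D. It starts from the constant term b of an integral equation of an element
    of D outside I, made monic by a shear. *)
Lemma relative_normalization (I D : set {mpoly C[N]}) :
  is_prime_ideal I -> is_ideal D -> ~ D 1 -> I `<=` D ->
  (exists2 f, D f & ~ I f) ->
  exists m (l : m.-tuple {mpoly C[N]}) (z : {mpoly C[N]}) (beta : {poly {mpoly C[m]}}),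
    [/\ finite_over (ext_subst l z) I,
        (forall g, I (ext_subst l z g) -> g = 0),
        beta \is monic & D (ext_subst l z beta)].
Proof.
move=> hI hD D1 ID [f Df nIf].
have hI' := prime_ideal hI.
have [m [l [fin inj]]] := noether_normalization hI' (prime_proper hI).
have [b [g [nIb Ib]]] := integral_contract hI (fin f) nIf.
have Db : D (b \mPo l).
  by apply: (iffRL (ideal_subl hD (ID _ Ib))); apply: ideal_Mr.
have bn : b != 0.
  by apply/eqP => b0; apply: nIb; rewrite b0 rmorph0; apply: ideal_0.
case: m l fin inj b nIb Ib Db bn => [|m] l fin inj b nIb Ib Db bn.
  case: D1; apply: (@ideal_mpolyC D b@_0%MM) => //.
    by apply: contra bn => /eqP b0; rewrite (mpoly0_const b) b0.
  by move: Db; rewrite {1}(mpoly0_const b) comp_mpolyC.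
have [c [beta [a [bm bE]]]] := exists_monic_shear bn.
exists m, (shear c l), (tnth l ord_max), beta; split=> //.
- exact: finite_over_shear.
- move=> h; rewrite -unshearP => /inj /(congr1 (shear_poly c)).
  by rewrite shear_polyK rmorph0.
- rewrite bE shear_polyP comp_mpolyZ -mul_mpolyC rmorphM /=.
  by apply: (ideal_M hD); apply: (ideal_M hD).
Qed.

End Normalization.

(** * Closed points over a finite projection *)

(** A prime ideal lying over the ideal of the point y contains a linear factor
    of an integral equation of each variable, hence is the ideal of a point. *)
Lemma point_over (C : closedFieldType) (N m : nat) (l : m.-tuple {mpoly C[N]})
    (I : set {mpoly C[N]}) (y : 'I_m -> C) :
  is_ideal I -> finite_over (comp_mpoly l) I ->
  (forall b : {mpoly C[m]}, I (b \mPo l) -> b.@[y] = 0) ->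
  exists q : 'I_N -> C, (forall f, I f -> f.@[q] = 0) /\
    forall b : {mpoly C[m]}, (b \mPo l).@[q] = b.@[y].
Proof.
move=> hI fin hy.
have hm : is_prime_ideal [set b : {mpoly C[m]} | b.@[y] = 0].
  split=> [|/eqP|f g /eqP]; last by rewrite mevalM mulf_eq0 => /orP[] /eqP; [left|right].
    by split=> /= [|f g hf hg|a f hf]; rewrite ?meval0 ?mevalD ?mevalM ?hf ?hg ?addr0 ?mulr0.
  by rewrite meval1 oner_eq0.
have [Q [hQ IQ Qy]] := lying_over hI hm fin hy.
have hQ' := prime_ideal hQ.
have Q1 := prime_proper hQ.
have QC c : Q c%:MP -> c = 0.
  by move=> Qc; apply/eqP; apply: contraT => cn; case: Q1; apply: ideal_mpolyC Qc.
have [K [pi [piE pi_surj]]] := exists_quotient hQ' Q1.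
have pi_l b : pi (b \mPo l) = pi (b.@[y])%:MP.
  apply/eqP; rewrite -subr_eq0 -rmorphB; apply/eqP/piE.
  rewrite -(comp_mpolyC _ l) -rmorphB; apply/Qy => /=.
  by rewrite mevalB mevalC subrr.
have root i : exists x, Q ('X_i - x%:MP).
  have [p pm hp] := fin 'X_i.
  pose py := map_poly (meval y) p.
  have pym : py \is monic by exact: monic_map.
  have [s sE] := closed_field_poly_normal py.
  rewrite (monicP pym) scale1r in sE.
  have : Q (\prod_(x <- s) ('X_i - x%:MP)).
    apply/piE; rewrite rmorph_prod /=.
    have -> : \prod_(x <- s) pi ('X_i - x%:MP) = (map_poly (pi \o @mpolyC N C) py).[pi 'X_i].
      rewrite sE rmorph_prod horner_prod; apply: eq_bigr => x _ /=.
      by rewrite !rmorphB /= map_polyX map_polyC !hornerE.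
    have := IQ _ hp; move/piE; rewrite -horner_map -map_poly_comp /py -map_poly_comp => <-.
    by congr (_.[_]); apply: eq_map_poly => b /=; rewrite pi_l.
  elim: s {sE} => [|x s IHs]; first by rewrite big_nil => /Q1.
  by rewrite big_cons => /(prime_M hQ)[Qx|/IHs//]; exists x.
have [q hq] := choice root.
have pi_q f : pi f = pi (f.@[q])%:MP.
  apply: (mpoly_rmorph_ext (phi := pi) (psi := pi \o (@mpolyC N C \o meval q))) => [c|i] /=.
    by rewrite mevalC.
  rewrite mevalXU; apply/eqP; rewrite -subr_eq0 -rmorphB; apply/eqP/piE.
  exact: hq.
exists q; split=> [f /IQ /piE|b].
  by rewrite pi_q => /piE /QC.
apply/eqP; rewrite -subr_eq0; apply/eqP/QC/piE.
by rewrite mpolyCB rmorphB /= -pi_q pi_l subrr.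
Qed.

Section HomogeneousZeros.
Variables (C : closedFieldType) (n : nat).
Implicit Types (Z W X : set (coords C n)).

Definition homog_zeros (P : set {mpoly C[n.+1]}) : set (coords C n) :=
  [set p | @projective_space C n p /\
    forall f, P f /\ (exists d, f \is d.-homog) -> f.@[p] = 0].

Lemma homog_zeros_closed P : zclosed (homog_zeros P).
Proof.
by exists [set f | P f /\ exists d, f \is d.-homog]; split=> // f [].
Qed.

Lemma sub_vanishing_zeros (P : set {mpoly C[n.+1]}) :
  closed_under (@component_of C n) P -> P `<=` vanishing (homog_zeros P).
Proof.
move=> Pc f Pf p [_ hp]; rewrite -(scale_pt1 p) -horner_cone_poly.
suff -> : cone_poly p f = 0 by rewrite horner0.
apply/polyP => d; rewrite coef_cone_poly coef0; apply: hp; split.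
  by apply: (Pc _ _ Pf); exists d.
by exists d; exact: pihomogP.
Qed.

Lemma not_sub_closed W A : zclosed A -> W `<=` @projective_space C n ->
  ~ W `<=` A -> exists f d, [/\ f \is d.-homog, vanishing A f & ~ vanishing W f].
Proof.
move=> [F [Fh AE]] Wpr /existsNP[q /not_implyP[Wq nAq]].
have [f [Ff nf]] : exists f, F f /\ f.@[q] <> 0.
  apply: contrapT => h; apply: nAq; rewrite AE; split; first exact: Wpr.
  by move=> f Ff; apply: contrapT => nf; apply: h; exists f.
have [d fd] := Fh _ Ff; exists f, d; split=> //; last by move=> /(_ _ Wq).
by move=> p; rewrite AE => -[_ /(_ _ Ff)].
Qed.

(** Let P be maximal among the homogeneous ideals containing D and meeting the
    base ring in 0. As the fibres of the projection are nonempty, the ideal of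
    the zeros of P still meets the base ring in 0, so it is P; and P is prime.
    When 0 < m, a fibre can be chosen that avoids the vertex of the cone. *)
Lemma exists_dominant_irreducible (m : nat) (l : m.-tuple {mpoly C[n.+1]})
    (D : set {mpoly C[n.+1]}) :
  (0 < m)%N -> is_ideal D -> closed_under (@component_of C n) D ->
  finite_over (comp_mpoly l) D -> (forall b, D (b \mPo l) -> b = 0) ->
  exists W, [/\ irreducible_closed W, D `<=` vanishing W &
    forall b, vanishing W (b \mPo l) -> b = 0].
Proof.
move=> m0 hD Dc fin DB.
pose T : set {mpoly C[n.+1]} := [set f | exists2 b, b != 0 & f = b \mPo l].
have [||P Pmax DP] := @exists_maximal_avoiding _ (@component_of C n) T D hD.
- exact: Dc.
- by move=> f Df [b bn fb]; move: Df bn; rewrite fb => /DB ->; rewrite eqxx.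
have [hP Pc PT Pmax'] := Pmax.
set W := homog_zeros P.
have PW := sub_vanishing_zeros Pc; rewrite -/W in PW.
have WB b : vanishing W (b \mPo l) -> b = 0.
  move=> hb; apply/eqP; apply: contraT => bn.
  pose j := Ordinal m0; pose a := (tnth l j).@[fun=> 0].
  have jn : 'X_j - a%:MP != 0 :> {mpoly C[m]}.
    apply/eqP => /(congr1 (meval (fun=> a + 1))) /eqP.
    by rewrite mevalB mevalXU mevalC meval0 addrAC subrr add0r oner_eq0.
  have [y] := mpoly_neq0_point (mulf_neq0 bn jn).
  rewrite mevalM mulf_eq0 negb_or => /andP[yb yj].
  have finP : finite_over (comp_mpoly l) P.
    by move=> f; apply: integral_mod_sub DP (fin f).
  have [|q [qP ql]] := point_over (y := y) hP finP.
    move=> b' Pb'; have -> : b' = 0; last by rewrite meval0.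
    apply/eqP; apply: contraT => b'n; case: (PT _ Pb').
    by exists b'.
  have Wq : W q.
    split; last by move=> f [Pf _]; exact: qP.
    apply: contrapT => nq; move: yj; rewrite mevalB mevalXU mevalC.
    have := ql 'X_j; rewrite comp_mpoly_var mevalXU => <-.
    rewrite (meval_eq (v2 := fun=> 0)) ?subrr ?eqxx // => i.
    by apply/eqP; apply: contraT => qi; case: nq; exists i.
  by move: yb; rewrite -ql (hb _ Wq) eqxx.
have WP : vanishing W `<=` P.
  apply: Pmax' => //.
  - exact: vanishing_ideal.
  - exact: vanishing_components (zclosed_cone (homog_zeros_closed _)).
  - by move=> f hf [b bn fb]; move: hf bn; rewrite fb => /WB ->; rewrite eqxx.
exists W; split=> //; last by move=> f /DP /PW.
split; first exact: homog_zeros_closed.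
- apply: contrapT => W0; have : (1 : {mpoly C[m]}) = 0.
    by apply: WB => p Wp; case: W0; exists p.
  by apply/eqP; rewrite oner_eq0.
move=> A B Acl Bcl WAB; apply: contrapT => /not_orP[nA nB].
have Wpr := zclosed_proj (homog_zeros_closed P).
have [f [d [fd fA fW]]] := not_sub_closed Acl Wpr nA.
have [g [e [ge gB gW]]] := not_sub_closed Bcl Wpr nB.
have TM s t : T s -> T t -> T (s * t).
  move=> [b bn ->] [c cn ->]; exists (b * c); first by rewrite mulf_neq0.
  by rewrite rmorphM.
have adj h i : h \is i.-homog -> closed_under (@component_of C n) (ideal_adjoin P h).
  move=> hi _ _ [x [a [Px ->]]] [k ->].
  exists (pihomog mdeg k x), (if (i <= k)%N then pihomog mdeg (k - i) a else 0).
  split; first by apply: (Pc _ _ Px); exists k.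
  by rewrite pihomogD (pihomog_mul_homog _ _ hi); case: ifP; rewrite ?mul0r.
case: (maximal_avoiding_prime Pmax TM (adj _ _ fd) (adj _ _ ge)) => [|/PW//|/PW//].
apply: WP => p Wp; rewrite mevalM; case: (WAB p Wp) => [/fA ->|/gB ->].
  by rewrite mul0r.
by rewrite mulr0.
Qed.

End HomogeneousZeros.

(** * Chains of irreducible closed sets *)

Section Chains.
Variables (C : closedFieldType) (n : nat).
Implicit Types (Z X : set (coords C n)).

Lemma proper_vanishing Y Z : zclosed Y -> irreducible_closed Z -> Y `<` Z ->
  exists2 f, vanishing Y f & ~ vanishing Z f.
Proof.
move=> Ycl [Zcl _ _] [YZ ZY].
have [f [_ [_ fY fZ]]] := not_sub_closed Ycl (zclosed_proj Zcl) ZY.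
by exists f.
Qed.

Lemma proper_vanishing_base (A : comNzRingType) (theta : {rmorphism A -> {mpoly C[n.+1]}})
    X Y Z : finite_over theta (vanishing X) -> Z `<=` X ->
  zclosed Y -> irreducible_closed Z -> Y `<` Z ->
  exists a, vanishing Y (theta a) /\ ~ vanishing Z (theta a).
Proof.
move=> fin ZX Ycl Zirr YZ.
have [f fY fZ] := proper_vanishing Ycl Zirr YZ.
have [a [g [nZ Za]]] := integral_contract (vanishing_prime Zirr)
  (integral_mod_sub (sub_vanishing ZX) (fin f)) fZ.
exists a; split=> //.
have hY := vanishing_ideal Y.
apply: (iffRL (ideal_subl hY (sub_vanishing (proj1 YZ) Za))).
exact: (ideal_Mr hY).
Qed.

(** A coordinate function takes infinitely many values on a cone, so no
    nonempty closed set is finite over the constants. *)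
Lemma not_finite_over_constants Z (l : 0.-tuple {mpoly C[n.+1]}) :
  zclosed Z -> Z !=set0 -> ~ finite_over (comp_mpoly l) (vanishing Z).
Proof.
move=> Zcl [p Zp] fin.
have [i pi] := zclosed_proj Zcl Zp.
have [q qm hq] := fin 'X_i.
pose v (j : 'I_0) : C := 0.
have qv0 : map_poly (meval v) q = 0.
  apply: poly_eq0_on_units => x xn.
  have := hq _ (zclosed_cone Zcl (mulf_neq0 xn (invr_neq0 pi)) Zp).
  rewrite -horner_map -map_poly_comp /= mevalXU /scale_pt -mulrA mulVf // mulr1.
  move=> h; rewrite -[RHS]h; congr (_.[_]); apply: eq_map_poly => b /=.
  by rewrite (mpoly0_const b) comp_mpolyC !mevalC.
have := monic_neq0 (monic_map (meval v) qm).
by rewrite qv0 eqxx.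
Qed.

Lemma irreducible_chain_last X (l : nat) (Z : nat -> set (coords C n)) : irreducible_chain X l.+1 Z ->
  exists Y : nat -> set (coords C n), irreducible_chain X 1 Y.
Proof.
move=> [irr sub ZX]; exists (fun i => Z (l + i)%N); split.
- by move=> i i1; apply: irr; rewrite -addn1 leq_add2l.
- by move=> [|//] _; rewrite addn0 addn1; apply: sub.
- by rewrite addn1.
Qed.

End Chains.

(** * Sections of negative degree *)

Section NegativeSection.
Variables (C : closedFieldType) (n : nat).
Variables (X U : set (coords C n)) (M : nat) (sigma : coords C n -> C).
Hypotheses (Xirr : irreducible_closed X) (Uopen : zopen_in X U) (M0 : (0 < M)%N).
Hypothesis sigma_sec : twist_section (- M%:Z) U sigma.

Let Xcl : zclosed X. Proof. by case: Xirr. Qed.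
Let Xpr : X `<=` @projective_space C n. Proof. exact: zclosed_proj. Qed.
Let I := vanishing X.
Let hI : is_prime_ideal I. Proof. exact: vanishing_prime. Qed.
Let UX : U `<=` X. Proof. by case: Uopen => Z _ -> p []. Qed.

Lemma zopen_basis p : U p -> exists F : {mpoly C[n.+1]},
  [/\ exists d, F \is d.-homog, F.@[p] != 0 & forall q, X q -> F.@[q] != 0 -> U q].
Proof.
case: Uopen => Z [F [Fh ZE]] UE; rewrite UE => -[Xp nZp].
have [f [Ff nf]] : exists f, F f /\ f.@[p] <> 0.
  apply: contrapT => h; apply: nZp; rewrite ZE; split; first exact: Xpr.
  by move=> f Ff; apply: contrapT => nf; apply: h; exists f.
exists f; split; [exact: Fh | exact/eqP |].
move=> q Xq fq; split=> //; rewrite ZE => -[_ /(_ _ Ff)] /eqP.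
by rewrite (negPf fq).
Qed.

Lemma vanishing_open f : U !=set0 -> (forall p, U p -> f.@[p] = 0) -> I f.
Proof.
move=> [p Up] hf; have [F [_ Fp FU]] := zopen_basis Up.
have : I (f * F).
  move=> q Xq; rewrite mevalM; have [->|Fq] := eqVneq F.@[q] 0.
    by rewrite mulr0.
  by rewrite hf ?mul0r //; apply: FU.
case/(prime_M hI) => // /(_ p (UX Up)) /eqP.
by rewrite (negPf Fp).
Qed.

Let Ucone : is_cone U.
Proof.
case: Uopen => Z Zcl UE p l ln; rewrite UE => -[Xp nZp]; split.
  exact: zclosed_cone.
move=> Zlp; apply: nZp.
have := zclosed_cone Zcl (invr_neq0 ln) Zlp.
suff -> : scale_pt l^-1 (scale_pt l p) = p by [].
by apply/funext => i; rewrite /scale_pt mulrA mulVf // mul1r.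
Qed.

Lemma section_scale p l : U p -> l != 0 ->
  l ^+ M * sigma (scale_pt l p) = sigma p.
Proof.
move=> Up ln; have [dg [dh [g [h [deg gh hh hp sE]]]]] := sigma_sec Up.
have Ulp := Ucone ln Up.
have hlp : h.@[scale_pt l p] = l ^+ dh * h.@[p] by exact: meval_homog.
have glp : g.@[scale_pt l p] = l ^+ dg * g.@[p] by exact: meval_homog.
have dE : dh = (dg + M)%N.
  by apply/eqP; rewrite -eqz_nat PoszD deg subrK.
rewrite (sE _ Up hp) (sE _ Ulp); last by rewrite hlp mulf_neq0 ?expf_neq0.
rewrite hlp glp dE exprD.
by field; rewrite hp !expf_neq0.
Qed.

Lemma section_global p : U p -> exists g h : {mpoly C[n.+1]},
  h.@[p] != 0 /\ forall q, U q -> h.@[q] * sigma q = g.@[q].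
Proof.
move=> Up; have [_ [_ [g [h [_ _ _ hp sE]]]]] := sigma_sec Up.
exists g, h; split=> // q Uq.
have [_ [_ [g1 [h1 [_ _ _ h1q s1E]]]]] := sigma_sec Uq.
have : I ((h * g1 - g * h1) * (h * h1)).
  apply: vanishing_open; first by exists p.
  move=> x Ux; rewrite !mevalM mevalB !mevalM.
  have [->|hx] := eqVneq h.@[x] 0; first by rewrite !mul0r mulr0.
  have [->|h1x] := eqVneq h1.@[x] 0; first by rewrite !mulr0.
  have := sE _ Ux hx; rewrite (s1E _ Ux h1x) => /eqP.
  rewrite eqr_div // => /eqP E.
  by rewrite [_ * g1.@[x]]mulrC E subrr mul0r.
case/(prime_M hI) => [/(_ q (UX Uq))|/(prime_M hI)[/(_ p (UX Up))|/(_ q (UX Uq))]]; last 2 first.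
- by move/eqP; rewrite (negPf hp).
- by move/eqP; rewrite (negPf h1q).
rewrite mevalB !mevalM => /eqP; rewrite subr_eq0 => /eqP E.
by rewrite (s1E _ Uq h1q) mulrA E mulfK.
Qed.

(* the ideal of denominators of sigma *)
Let D : set {mpoly C[n.+1]} := [set f | exists v : {mpoly C[n.+1]},
  forall q, U q -> f.@[q] * sigma q = v.@[q]].

Let hD : is_ideal D.
Proof.
split=> [|f g [v hv] [w hw]|a f [v hv]].
- by exists 0 => q _; rewrite !meval0 mul0r.
- by exists (v + w) => q Uq; rewrite !mevalD mulrDl hv // hw.
- by exists (a * v) => q Uq; rewrite !mevalM -mulrA hv.
Qed.

Let ID : I `<=` D.
Proof. by move=> f If; exists 0 => q Uq; rewrite meval0 If ?mul0r //; apply: UX. Qed.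

Let cone_section f v p : U p ->
    (forall q, U q -> f.@[q] * sigma q = v.@[q]) ->
  sigma p *: cone_poly p f = 'X^M * cone_poly p v.
Proof.
move=> Up hv; apply/eqP; rewrite -subr_eq0; apply/eqP/poly_eq0_on_units => l ln.
rewrite !hornerE !horner_cone_poly -(section_scale Up ln).
have := hv _ (Ucone ln Up); rewrite /scale_pt => <-.
by apply/eqP; rewrite subr_eq0; apply/eqP; ring.
Qed.

Let Dc : closed_under (@component_of C n) D.
Proof.
move=> f _ [v hv] [d ->].
exists (if (M <= d)%N then pihomog mdeg (d - M) v else 0) => q Uq.
have := congr1 (fun P : {poly C} => P`_d) (cone_section Uq hv).
rewrite /= coefZ coefXnM coef_cone_poly mulrC => ->.
by case: ltnP => _; rewrite ?meval0 // coef_cone_poly.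
Qed.

Let section_integral : D 1 -> forall p, U p -> sigma p = 0.
Proof.
move=> [v hv] p Up.
have := congr1 (fun P : {poly C} => P`_0) (cone_section Up hv).
rewrite /= coefZ coefXnM M0 coef_cone_poly pihomog_dE ?dhomog1 //.
by rewrite meval1 mulr1.
Qed.

(** With u1 = r sigma, the powers of sigma have a bounded denominator c: on each
    line through the origin c sigma^j is a polynomial w_j. As sigma has negative
    degree, for large j the degrees on both sides are incompatible. *)
Let section_of_base_denominator m (l : m.-tuple {mpoly C[n.+1]}) z
    (beta : {poly {mpoly C[m]}}) r :
  finite_over (ext_subst l z) I -> (forall g, I (ext_subst l z g) -> g = 0) ->
  beta \is monic -> D (ext_subst l z beta) -> r != 0 -> D (r \mPo l) ->
  forall p, U p -> sigma p = 0.
Proof.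
move=> fin inj bm [u2 hu2] rn [u1 hu1] p Up.
have [K [pi [piE pi_surj]]] := exists_quotient (prime_ideal hI) (prime_proper hI).
pose theta : {rmorphism {poly {mpoly C[m]}} -> K} := pi \o ext_subst l z.
have intK u : integralOver theta (pi u).
  have [P Pm hP] := fin u; exists P => //.
  by rewrite /theta map_poly_comp rootE horner_map; apply/eqP/piE.
have [||c cn hc] := bounded_denominator (theta := theta) _ rn bm (intK u1) (intK u2).
- by move=> a /piE /inj.
- rewrite /theta /= ext_substC -!rmorphM; apply/eqP; rewrite -subr_eq0 -rmorphB.
  apply/eqP/piE; apply: vanishing_open; first by exists p.
  by move=> q Uq; rewrite mevalB !mevalM -hu1 // -hu2 //; ring.
pose c' := ext_subst l z c; pose r' := r \mPo l.
have Ic : ~ I c' by move=> /inj c0; rewrite c0 eqxx in cn.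
have Ir : ~ I r'.
  by rewrite /r' -(ext_substC _ z) => /inj /eqP; rewrite polyC_eq0 (negPf rn).
have zero q : U q -> c'.@[q] != 0 -> r'.@[q] != 0 -> sigma q = 0.
  move=> Uq cq rq; apply/eqP; apply: contraT => sn.
  pose ch := cone_poly q c'; pose rh := cone_poly q r'; pose j := size ch.
  have rhn : rh != 0.
    apply: contraNneq rq => r0.
    by rewrite -(scale_pt1 q) -horner_cone_poly [cone_poly _ _]r0 horner0.
  have chn : ch != 0.
    apply: contraNneq cq => r0.
    by rewrite -(scale_pt1 q) -horner_cone_poly [cone_poly _ _]r0 horner0.
  have [w' hw] := hc j; have [w wE] := pi_surj w'.
  have Iw : I (c' * u1 ^+ j - r' ^+ j * w).
    apply/piE; rewrite rmorphB !rmorphM !rmorphXn /= wE.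
    by have := hw; rewrite /theta /= ext_substC => ->; rewrite subrr.
  have := vanishing_cone_poly (zclosed_cone Xcl) Iw (UX Uq).
  rewrite cone_polyB !cone_polyM !cone_polyXn -/ch -/rh => /eqP.
  rewrite subr_eq0 => /eqP E.
  have E1 := cone_section Uq hu1; rewrite -/rh in E1.
  have E2 : sigma q ^+ j *: ch * rh ^+ j = 'X^(M * j) * cone_poly q w * rh ^+ j.
    rewrite exprM -[RHS]mulrA [_ * rh ^+ j]mulrC -E.
    by rewrite mulrCA -exprMn -E1 exprZn -scalerAl -scalerAr.
  have /(mulIf (expf_neq0 j rhn)) E3 := E2.
  have := congr1 (size \o polyseq) E3; rewrite /= size_scale ?expf_neq0 // -/j.
  have [w0|wn] := eqVneq (cone_poly q w) 0.
    by rewrite w0 mulr0 size_poly0 => /eqP; rewrite size_poly_eq0 (negPf chn).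
  rewrite mulrC size_mulXn // => jE.
  have : (j < j)%N.
    rewrite {2}jE -addn1 leq_add ?size_poly_gt0 //.
    by rewrite leq_pmull.
  by rewrite ltnn.
have [g [h [hp hs]]] := section_global Up.
have : I ((c' * r') * g).
  apply: vanishing_open; first by exists p.
  move=> q Uq; rewrite !mevalM -(hs _ Uq).
  have [->|cq] := eqVneq c'.@[q] 0; first by rewrite !mul0r.
  have [->|rq] := eqVneq r'.@[q] 0; first by rewrite mulr0 mul0r.
  by rewrite zero // !mulr0.
case/(prime_M hI) => [/(prime_M hI)[]//|/(_ p (UX Up)) g0].
have := hs _ Up; rewrite g0 => /eqP; rewrite mulf_eq0 (negPf hp).
by move/eqP.
Qed.

(** The graded ring of X is finite over C[l, z]. Either the denominators D
    contain a nonzero r in C[l] beside the monic beta, and these two suffice; or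
    some irreducible W on which sigma has poles dominates C[l], so that W has
    codimension at most 1. *)
Theorem negative_section_eq0 :
  (exists Z, irreducible_chain X 1 Z) ->
  (forall W, irreducible_closed W -> W `<=` X `\` U ->
    exists2 Z, irreducible_chain X 2 Z & Z 0%N = W) ->
  forall p, U p -> sigma p = 0.
Proof.
move=> [Y [Yirr Ysub YX]] codim p Up.
have [D1|D1] := pselect (D 1); first exact: section_integral.
have [f Df nIf] : exists2 f, D f & ~ I f.
  have [g [h [hp hs]]] := section_global Up.
  exists h; first by exists g.
  by move=> /(_ p (UX Up)) /eqP; rewrite (negPf hp).
have [m [l [z [beta [fin inj bm Db]]]]] :=
  relative_normalization hI hD D1 ID (ex_intro2 _ _ f Df nIf).
have inj_v Z a : Z `<=` X -> ~ vanishing Z (ext_subst l z a) -> a != 0.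
  by move=> _ h; apply/eqP => a0; apply: h; rewrite a0 rmorph0; apply: ideal_0; apply: vanishing_ideal.
have m0 : (0 < m)%N.
  case: m l beta fin inj bm Db inj_v => // l beta fin inj _ _ inj_v; exfalso.
  have [Y0cl Y0n _] := Yirr 0%N isT.
  have [a [aY0 aY1]] := proper_vanishing_base fin YX Y0cl (Yirr 1%N isT) (Ysub 0%N isT).
  have an := inj_v _ _ YX aY1.
  have hY0 := vanishing_ideal (Y 0%N).
  have lcE : lead_coef a = ((lead_coef a)@_0%MM)%:MP by exact: mpoly0_const.
  set t := _@_0%MM in lcE.
  have tn : t != 0.
    by apply: contra an => /eqP t0; rewrite -lead_coef_eq0 lcE t0.
  apply: (@not_finite_over_constants _ _ (Y 0%N) l Y0cl Y0n).
  apply: (@finite_over_ext _ _ _ _ l z (t^-1%:MP *: a)) => //.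
  - move=> g; apply: integral_mod_sub (fin g); apply: sub_vanishing.
    by apply: subset_trans YX; case: (Ysub 0%N isT).
  - by rewrite monicE lead_coefZ lcE -mpolyCM mulVf.
  - by rewrite -mul_polyC rmorphM /=; apply: (ideal_M hY0).
have finD : finite_over (comp_mpoly l) D.
  by apply: finite_over_ext Db => // g; apply: integral_mod_sub (fin g).
have [[r rn Dr]|noB] := pselect (exists2 r, r != 0 & D (r \mPo l)).
  exact: (section_of_base_denominator fin inj bm Db rn Dr Up).
exfalso.
have DB b : D (b \mPo l) -> b = 0.
  by move=> h; apply/eqP; apply: contraT => bn; case: noB; exists b.
have [W [Wirr DW WB]] := exists_dominant_irreducible m0 hD Dc finD DB.
have WX : W `<=` X.
  have [Wcl _ _] := Wirr.
  by apply: zclosed_sub => //; [exact: zclosed_proj | move=> g /ID /DW].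
have [|Z [Zirr Zsub ZX] Z0] := codim W Wirr.
  move=> q Wq; split; first exact: WX.
  move=> Uq; have [g [h [hq hs]]] := section_global Uq.
  have : vanishing W h by apply: DW; exists g.
  by move=> /(_ q Wq) /eqP; rewrite (negPf hq).
have Z1X : Z 1%N `<=` X by apply: subset_trans ZX; case: (Zsub 1%N isT).
have Zcl i : (i <= 2)%N -> zclosed (Z i) by move=> /Zirr [].
have [a0 [a0Z0 a0Z1]] := proper_vanishing_base fin Z1X (Zcl 0%N isT) (Zirr 1%N isT) (Zsub 0%N isT).
have [a1 [a1Z1 a1Z2]] := proper_vanishing_base fin ZX (Zcl 1%N isT) (Zirr 2%N isT) (Zsub 1%N isT).
have a1n := inj_v _ _ ZX a1Z2.
pose trace Z' := [set a | vanishing Z' (ext_subst l z a)].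
have traceI Z' : is_ideal (trace Z').
  have hZ' := vanishing_ideal Z'.
  split=> [|a b ha hb|a b hb]; rewrite /trace /=.
  - by rewrite rmorph0; apply: (ideal_0 hZ').
  - by rewrite rmorphD; apply: (ideal_D hZ').
  - by rewrite rmorphM; apply: (ideal_M hZ').
apply: a0Z1; apply: (@prime_poly_height1 _ (trace (Z 0%N)) (trace (Z 1%N))) => //.
- have hZ1 := vanishing_prime (Zirr 1%N isT); split=> // [|a b].
    by rewrite /trace /= rmorph1; apply: (prime_proper hZ1).
  by rewrite /trace /= rmorphM => /(prime_M hZ1).
- by move=> a; apply: sub_vanishing; case: (Zsub 0%N isT).
- by move=> b; rewrite /trace /= ext_substC Z0 => /WB.
- by exists a1.
Qed.

End NegativeSection.

(** * Gradients *)

Section Gradient.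
Variables (C : closedFieldType) (N : nat) (p : 'I_N -> C).
Implicit Types (f g : {mpoly C[N]}).

Definition grad g : 'rV[C]_N := \row_j (mderiv j g).@[p].

Lemma gradD f g : grad (f + g) = grad f + grad g.
Proof. by apply/rowP => j; rewrite !mxE mderivD mevalD. Qed.

Lemma gradB f g : grad (f - g) = grad f - grad g.
Proof. by apply/rowP => j; rewrite !mxE mderivB mevalB. Qed.

Lemma gradM f g : grad (f * g) = g.@[p] *: grad f + f.@[p] *: grad g.
Proof. by apply/rowP => j; rewrite !mxE mderivM mevalD !mevalM [_ * g.@[p]]mulrC. Qed.

Lemma gradC c : grad c%:MP = 0.
Proof. by apply/rowP => j; rewrite !mxE mderivC meval0. Qed.

Lemma gradX i : grad 'X_i = delta_mx 0 i.
Proof.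
apply/rowP => j; rewrite !mxE /= mderivX mnm1E eq_sym.
case: eqVneq => [->|_]; last by rewrite scale0r meval0.
have -> : (U_(i) - U_(i))%MM = 0%MM :> 'X_{1..N}.
  by apply/mnmP => a; rewrite mnmBE mnm0E subnn.
by rewrite scale1r mpolyX0 meval1.
Qed.

Definition pt_col : 'cV[C]_N := \col_j p j.

(** By the product rule Euler's relation passes from variables to monomials. *)
Lemma grad_euler f d : f \is d.-homog ->
  grad f *m pt_col = (d%:R * f.@[p])%:M.
Proof.
have monom (k : 'X_{1..N}) : grad 'X_[k] *m pt_col = ((mdeg k)%:R * ('X_[k]).@[p])%:M.
  rewrite mpolyXE_id mdegE.
  elim/big_ind2: _ => [|x a y b hx hy|i _].
  - by rewrite gradC mul0mx mul0r raddf0.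
  - rewrite gradM mulmxDl -!scalemxAl hx hy mevalM natrD.
    by rewrite !scale_scalar_mx -raddfD; congr (_%:M); ring.
  - elim: (k i) => [|e IHe]; first by rewrite expr0 gradC mul0mx mul0r raddf0.
    rewrite exprS gradM mulmxDl -!scalemxAl IHe gradX -rowE mevalM mevalXU.
    have -> : row i pt_col = (p i)%:M.
      by apply/matrixP => a b; rewrite !ord1 !mxE eqxx.
    by rewrite !scale_scalar_mx -raddfD; congr (_%:M); rewrite -natr1; ring.
move=> fd.
have -> : grad f *m pt_col = \sum_(k <- msupp f) f@_k *: (grad 'X_[k] *m pt_col).
  rewrite {1}[f]mpolyE; elim/big_ind2: _ => [||k _].
  - by rewrite gradC mul0mx.
  - by move=> x a y b <- <-; rewrite gradD mulmxDl.
  - by rewrite -mul_mpolyC gradM gradC scaler0 add0r mevalC scalemxAl.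
rewrite [in RHS](mpolyE f) (rmorph_sum (meval p)) mulr_sumr raddf_sum big_seq [RHS]big_seq.
apply: eq_bigr => k kf; rewrite monom (dhomog_mf fd kf) scale_scalar_mx.
by rewrite /= mevalZ mulrCA.
Qed.
End Gradient.

(** * The Jacobian criterion *)

Lemma zclosed_hypersurface (C : closedFieldType) (n d : nat) (g : {mpoly C[n.+1]}) :
  g \is d.-homog ->
  zclosed [set q : coords C n | @projective_space C n q /\ g.@[q] = 0].
Proof.
move=> gd; exists [set g]; split=> [_ ->|]; first by exists d.
by apply/seteqP; split=> q [pr h]; split=> //; [move=> _ ->|apply: h].
Qed.

Lemma zopen_nonzero (C : closedFieldType) (n d : nat) (X : set (coords C n))
    (g : {mpoly C[n.+1]}) : X `<=` @projective_space C n -> g \is d.-homog ->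
  zopen_in X [set q | X q /\ g.@[q] != 0].
Proof.
move=> Xpr gd; eexists; first exact: (zclosed_hypersurface gd).
apply/seteqP; split=> q [Xq h]; split=> //; first by case=> _; apply/eqP.
by apply/eqP => gq; apply: h; split=> //; apply: Xpr.
Qed.

Section Jets.
Variables (C : closedFieldType) (n : nat) (X : set (coords C n)) (p : coords C n).
Hypothesis Xirr : irreducible_closed X.
Hypothesis Xp : X p.

(** tau is the gradient at p of an expression of sigma as a quotient of
    polynomials on a neighbourhood of p in X. It is determined by sigma only on
    tangent vectors. *)
Definition has_jet (sigma : coords C n -> C) (tau : 'rV[C]_n.+1) :=
  exists g h F : {mpoly C[n.+1]}, [/\ F.@[p] != 0,
    forall q, X q -> F.@[q] != 0 -> h.@[q] != 0 /\ sigma q = g.@[q] / h.@[q] &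
    tau = (h.@[p] ^- 2) *: (h.@[p] *: grad p g - g.@[p] *: grad p h)].

Lemma jet_unique sigma sigma' tau tau' (G : {mpoly C[n.+1]}) (v : 'cV_n.+1) :
  (forall g, vanishing X g -> grad p g *m v = 0) ->
  has_jet sigma tau -> has_jet sigma' tau' -> G.@[p] != 0 ->
  (forall q, X q -> G.@[q] != 0 -> sigma q = sigma' q) -> tau *m v = tau' *m v.
Proof.
move=> tan [g [h [F [Fp hF ->]]]] [g' [h' [F' [Fp' hF' ->]]]] Gp E.
have [hp sp] := hF p Xp Fp; have [hp' sp'] := hF' p Xp Fp'.
pose P := g * h' - g' * h; pose R := F * F' * G.
have Rp : R.@[p] != 0 by rewrite !mevalM !mulf_neq0.
have PR : vanishing X (P * R).
  move=> q Xq; rewrite mevalM; have [->|] := eqVneq R.@[q] 0; first by rewrite mulr0.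
  rewrite /R !mevalM !mulf_eq0 !negb_or => /andP[/andP[Fq Fq'] Gq].
  have [hq sq] := hF q Xq Fq; have [hq' sq'] := hF' q Xq Fq'.
  have := E q Xq Gq; rewrite sq sq' => /eqP; rewrite eqr_div // => /eqP Eq.
  by rewrite /P mevalB !mevalM Eq subrr mul0r.
have Pp : g.@[p] * h'.@[p] = g'.@[p] * h.@[p].
  have := E p Xp Gp; rewrite sp sp' => /eqP; rewrite eqr_div // => /eqP ->.
  by [].
pose ev (x : 'rV[C]_n.+1) := (x *m v) 0 0.
have evB x y : ev (x - y) = ev x - ev y by rewrite /ev mulmxBl mxE [X in _ + X]mxE.
have evD x y : ev (x + y) = ev x + ev y by rewrite /ev mulmxDl mxE.
have evZ a x : ev (a *: x) = a * ev x by rewrite /ev -scalemxAl mxE.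
have EP : ev (grad p P) = 0.
  have : ev (grad p (P * R)) = 0 by rewrite /ev tan // mxE.
  rewrite gradM evD !evZ.
  have -> : P.@[p] = 0 by rewrite /P mevalB !mevalM Pp subrr.
  by rewrite mul0r addr0 => /eqP; rewrite mulf_eq0 (negPf Rp) => /eqP.
suff h0 : ev (h.@[p] ^- 2 *: (h.@[p] *: grad p g - g.@[p] *: grad p h)) =
    ev (h'.@[p] ^- 2 *: (h'.@[p] *: grad p g' - g'.@[p] *: grad p h')).
  by apply/matrixP => i j; rewrite !ord1.
move: EP; rewrite /P gradB !gradM evB !evD !evZ.
rewrite !evB !evZ.
set a := ev (grad p g); set b := ev (grad p h).
set c := ev (grad p g'); set d := ev (grad p h').
have gE : g.@[p] = g'.@[p] * h.@[p] / h'.@[p] by rewrite -Pp mulfK.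
rewrite gE => E0.
have -> : a = (h.@[p] * c + g'.@[p] * b - g'.@[p] * h.@[p] / h'.@[p] * d) / h'.@[p].
  by apply: (mulIf hp'); rewrite divfK // -[RHS]addr0 -E0; ring.
by field; rewrite hp hp'.
Qed.

Lemma jetD s1 s2 t1 t2 : has_jet s1 t1 -> has_jet s2 t2 ->
  has_jet (fun q => s1 q + s2 q) (t1 + t2).
Proof.
move=> [g1 [h1 [F1 [F1p hF1 ->]]]] [g2 [h2 [F2 [F2p hF2 ->]]]].
have [h1p _] := hF1 p Xp F1p; have [h2p _] := hF2 p Xp F2p.
exists (g1 * h2 + g2 * h1), (h1 * h2), (F1 * F2); split.
- by rewrite mevalM mulf_neq0.
- move=> q Xq; rewrite mevalM mulf_eq0 negb_or => /andP[F1q F2q].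
  have [h1q ->] := hF1 q Xq F1q; have [h2q ->] := hF2 q Xq F2q.
  rewrite mevalM mulf_neq0 // mevalD !mevalM; split=> //.
  by rewrite addf_div.
apply/rowP => j; rewrite gradD !gradM !mxE mevalD !mevalM.
by field; rewrite h1p h2p.
Qed.

Lemma jetM s1 s2 t1 t2 : has_jet s1 t1 -> has_jet s2 t2 ->
  has_jet (fun q => s1 q * s2 q) (s2 p *: t1 + s1 p *: t2).
Proof.
move=> [g1 [h1 [F1 [F1p hF1 ->]]]] [g2 [h2 [F2 [F2p hF2 ->]]]].
have [h1p ->] := hF1 p Xp F1p; have [h2p ->] := hF2 p Xp F2p.
exists (g1 * g2), (h1 * h2), (F1 * F2); split.
- by rewrite mevalM mulf_neq0.
- move=> q Xq; rewrite mevalM mulf_eq0 negb_or => /andP[F1q F2q].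
  have [h1q ->] := hF1 q Xq F1q; have [h2q ->] := hF2 q Xq F2q.
  rewrite !mevalM mulf_neq0 //; split=> //.
  by rewrite mulf_div.
apply/rowP => j; rewrite !gradM !mxE !mevalM.
by field; rewrite h1p h2p.
Qed.

Lemma jet0 : has_jet (fun=> 0) 0.
Proof.
exists 0, 1, 1; split=> [|q _ _|]; rewrite ?meval1 ?oner_neq0 //.
  by rewrite meval0 mul0r.
by rewrite meval0 scale0r gradC scaler0 subr0 scaler0.
Qed.

Lemma jet_sum c (s : 'I_c -> coords C n -> C) (t : 'I_c -> 'rV_n.+1) :
  (forall i, has_jet (s i) (t i)) ->
  has_jet (fun q => \sum_(i < c) s i q) (\sum_(i < c) t i).
Proof.
elim: c s t => [|c IHc] s t h.
  rewrite big_ord0; suff -> : (fun q => \sum_(i < 0) s i q) = (fun=> 0) by exact: jet0.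
  by apply/funext => q; rewrite big_ord0.
rewrite big_ord_recr /=.
suff -> : (fun q => \sum_(i < c.+1) s i q) =
    (fun q => (\sum_(i < c) s (widen_ord (leqnSn c) i) q) + s ord_max q).
  by apply: jetD => //; apply: IHc.
by apply/funext => q; rewrite big_ord_recr.
Qed.

Lemma regular_jet V f : zopen_in X V -> V p -> regular_on V f ->
  exists t, has_jet f t.
Proof.
move=> Vo Vp fr; have [_ [_ [g [h [_ _ _ hp fE]]]]] := fr p Vp.
have [F [_ Fp FV]] := zopen_basis Xirr Vo Vp.
eexists; exists g, h, (F * h); split; last by [].
  by rewrite mevalM mulf_neq0.
move=> q Xq; rewrite mevalM mulf_eq0 negb_or => /andP[Fq hq]; split=> //.
by apply: fE => //; apply: FV.
Qed.

(** Let v be tangent to X at p, killed by the differentials of the c parameters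
    and by one coordinate c0 with p_c0 != 0. The coordinate functions of the
    chart are combinations of the parameters up to constants, so v = 0: hence
    the r gradients of the equations, with c + 1 further conditions, have rank
    n + 1. *)
Lemma nonsingular_jacobian_rank r (f : 'I_r -> {mpoly C[n.+1]}) k :
  (forall i, vanishing X (f i)) ->
  (forall g, vanishing X g -> exists q, g = \sum_(i < r) q i * f i) ->
  (forall l Z, irreducible_chain X l Z -> (l <= k)%N) ->
  nonsingular_at X p -> (n <= \rank (\matrix_(i < r) grad p (f i)) + k)%N.
Proof.
move=> fX fgen dimX [c [[Z chZ _] _] [U [t [Uo Up tr tgen]]]].
have ck : (c <= k)%N by apply: dimX chZ.
have Xpr := zclosed_proj (let: And3 h _ _ := Xirr in h).
have [c0 pc0] := Xpr _ Xp.
have jt i : exists ti, has_jet (t i) ti by apply: (regular_jet Uo Up); case: (tr i).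
have [tau htau] := choice jt.
set J := \matrix_(i < r) _.
rewrite leqNgt; apply/negP => rk.
pose E := col_mx J (col_mx (\matrix_(i < c) tau i) (delta_mx 0 c0 : 'rV_n.+1)).
have rk_col (a b : nat) (A : 'M[C]_(a, n.+1)) (B : 'M[C]_(b, n.+1)) :
    (\rank (col_mx A B) <= \rank A + b)%N.
  rewrite -addsmxE (leq_trans (mxrank_adds_leqif _ _)) // leq_add2l.
  exact: rank_leq_row.
have rkE : (\rank E < n.+1)%N.
  rewrite ltnS (leq_trans (rk_col _ _ _ _)) // addn1.
  by rewrite -addSnnS (leq_trans _ rk) // addSn ltnS leq_add2l.
have [v vn Ev] : exists2 v : 'cV[C]_n.+1, v != 0 & E *m v = 0.
  have [j jn] : exists j, col j (cokermx E) != 0.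
    apply: contrapT => h; have : \rank (cokermx E) = 0%N.
      apply/eqP; rewrite mxrank_eq0; apply/eqP/matrixP => i j.
      have /eqP/matrixP/(_ i 0) : col j (cokermx E) == 0.
        by apply: contraT => jn; case: h; exists j.
      by rewrite !mxE.
    by rewrite mxrank_coker => /eqP; rewrite subn_eq0 leqNgt rkE.
  by exists (col j (cokermx E)) => //; rewrite colE mulmxA mulmx_coker mul0mx.
move: Ev; rewrite /E !mul_col_mx => /eqP; rewrite col_mx_eq0 => /andP[/eqP Jv].
rewrite col_mx_eq0 => /andP[/eqP tv /eqP c0v].
have fv i : grad p (f i) *m v = 0.
  by have := congr1 (row i) Jv; rewrite row_mul rowK row0.
have tauv i : tau i *m v = 0.
  by have := congr1 (row i) tv; rewrite row_mul rowK row0.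
have vc0 : v c0 0 = 0 by have := congr1 (fun A : 'M_1 => A 0 0) c0v; rewrite -rowE !mxE.
have tan g : vanishing X g -> grad p g *m v = 0.
  move=> /fgen[q ->]; elim/big_ind: _ => [|x y hx hy|i _].
  - by rewrite gradC mul0mx.
  - by rewrite gradD mulmxDl hx hy addr0.
  - by rewrite gradM (fX i p Xp) scale0r add0r -scalemxAl fv scaler0.
case/eqP: vn; apply/matrixP => j i; rewrite ord1 [RHS]mxE.
pose V := [set q | X q /\ ('X_c0 : {mpoly C[n.+1]}).@[q] != 0].
have X1 (i' : 'I_n.+1) : ('X_i' : {mpoly C[n.+1]}) \is 1.-homog by rewrite dhomogX; apply/eqP; exact: mdeg1.
have Vo : zopen_in X V by apply: (zopen_nonzero Xpr (X1 c0)).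
pose g := p c0 *: 'X_j - p j *: 'X_c0 : {mpoly C[n.+1]}.
pose h := p c0 *: 'X_c0 : {mpoly C[n.+1]}.
pose y (q : coords C n) := g.@[q] / h.@[q].
have hE q : h.@[q] = p c0 * q c0 by rewrite mevalZ mevalXU.
have gE q : g.@[q] = p c0 * q j - p j * q c0 by rewrite mevalB !mevalZ !mevalXU.
have Vp : V p by split=> //; rewrite mevalXU.
have yreg : regular_on V y.
  move=> q [Xq qc0]; exists 1%N, 1%N, g, h; split=> //.
  - by rewrite rpredB // dhomogZ.
  - by rewrite dhomogZ.
  - by rewrite hE mulf_neq0 // -mevalXU.
have gp : g.@[p] = 0 by rewrite gE mulrC subrr.
have y0 : y p = 0 by rewrite /y gp mul0r.
have [W [gg [Wo Wp WUV ggr yE]]] := tgen V y Vo Vp yreg y0.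
have jgg i' : exists ti, has_jet (gg i') ti by apply: (regular_jet Wo Wp).
have [tg htg] := choice jgg.
have jy := jet_sum (fun i' => jetM (htg i') (htau i')).
have jy' : has_jet y ((h.@[p] ^- 2) *: (h.@[p] *: grad p g - g.@[p] *: grad p h)).
  exists g, h, 'X_c0; split=> // [|q Xq]; rewrite mevalXU // => qc0.
  by split=> //; rewrite hE mulf_neq0.
have [F [_ Fp FW]] := zopen_basis Xirr Wo Wp.
have := jet_unique tan jy' jy Fp (fun q Xq Fq => yE q (FW q Xq Fq)).
rewrite [in RHS]mulmx_suml [RHS]big1; last first.
  move=> i' _; rewrite mulmxDl -!scalemxAl tauv scaler0 addr0.
  by have [_ ->] := tr i'; rewrite scale0r.
move/matrixP/(_ 0 0); rewrite [RHS]mxE.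
rewrite gp scale0r subr0 scalerA -scalemxAl mxE gradB -!mul_mpolyC !gradM !gradC.
rewrite !scaler0 !add0r !mevalC mulmxBl -!scalemxAl !gradX -!rowE.
rewrite !mxE vc0 mulr0 subr0 => /eqP; rewrite !mulf_eq0 invr_eq0 expf_eq0 /=.
by rewrite hE !mulf_eq0 (negPf pc0) /= => /eqP.
Qed.
End Jets.

(** * Alternating functions of k arguments *)

Lemma subst_at_id (k : nat) (T : Type) (a : 'I_k -> T) i : subst_at a i (a i) = a.
Proof. by apply/funext => j; rewrite /subst_at; case: eqP => [->|]. Qed.

Lemma subst_at_eq (k : nat) (T : Type) (a : 'I_k -> T) i x : subst_at a i x i = x.
Proof. by rewrite /subst_at eqxx. Qed.

Lemma subst_at_neq (k : nat) (T : Type) (a : 'I_k -> T) i j x :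
  j != i -> subst_at a i x j = a j.
Proof. by rewrite /subst_at => /negPf ->. Qed.

Lemma subst_atC (k : nat) (T : Type) (a : 'I_k -> T) i j x y : i != j ->
  subst_at (subst_at a i x) j y = subst_at (subst_at a j y) i x.
Proof.
move=> ij; apply/funext => l; rewrite /subst_at.
by case: (eqVneq l j) => [->|//]; rewrite eq_sym (negPf ij).
Qed.

Lemma subst_at_comp (k : nat) (T T' : Type) (g : T -> T') (a : 'I_k -> T) i x :
  (fun j => g (subst_at a i x j)) = subst_at (fun j => g (a j)) i (g x).
Proof. by apply/funext => j; rewrite /subst_at; case: eqP. Qed.

Lemma subst_at_all (k : nat) (T : Type) (Q : T -> Prop) (a : 'I_k -> T) i x :
  (forall j, Q (a j)) -> Q x -> forall j, Q (subst_at a i x j).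
Proof. by move=> ha hx j; rewrite /subst_at; case: eqP. Qed.

Section Multilinear.
Variables (F : fieldType) (T : Type) (reg : T -> Prop) (k : nat).
Variables (L : ('I_k -> T) -> F).

(** Expand one slot after the other: what remains are values of L on tuples
    taken from y. *)
Lemma multilinear_vanish (J : finType) (y : J -> T) :
  (forall j, reg (y j)) ->
  (forall b i, reg b -> exists s : J -> F, forall a, (forall j, reg (a j)) ->
     L (subst_at a i b) = \sum_j s j * L (subst_at a i (y j))) ->
  (forall t : 'I_k -> J, L (fun i => y (t i)) = 0) ->
  forall b, (forall i, reg (b i)) -> L b = 0.
Proof.
move=> yreg hexp hy.
suff key m : forall b, (forall i, reg (b i)) ->
    (forall i : 'I_k, (m <= i)%N -> exists j, b i = y j) -> L b = 0.
  by move=> b breg; apply: (key k) => // i; rewrite leqNgt ltn_ord.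
elim: m => [|m IHm] b breg hb.
  have [t ht] := choice (fun i => hb i (leq0n i)).
  by have -> : b = (fun i => y (t i)) by apply/funext.
have [mk|km] := ltnP m k; last first.
  by apply: IHm => // i mi; move: (leq_trans km mi); rewrite leqNgt ltn_ord.
pose i0 := Ordinal mk; have [s hs] := hexp (b i0) i0 (breg i0).
rewrite -(subst_at_id b i0) hs // big1 // => j _.
have -> : L (subst_at b i0 (y j)) = 0; last by rewrite mulr0.
apply: IHm => [|i mi]; first exact: subst_at_all.
have [->|ii0] := eqVneq i i0; first by exists j; rewrite subst_at_eq.
rewrite subst_at_neq //; apply: hb; rewrite ltn_neqAle mi andbT.
by apply: contra ii0 => /eqP h; apply/eqP/val_inj.
Qed.

(** Along a family of k elements only the permutations of that family are left
    after the expansion. *)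
Lemma alternating_vanish (e : 'I_k -> T) :
  (forall j, reg (e j)) ->
  (forall b i, reg b -> exists s : 'I_k -> F, forall a, (forall j, reg (a j)) ->
     L (subst_at a i b) = \sum_j s j * L (subst_at a i (e j))) ->
  (forall a i j, (forall l, reg (a l)) -> i != j -> a i = a j -> L a = 0) ->
  (forall a i j, (forall l, reg (a l)) -> i != j ->
     L (fun l => a (tperm i j l)) = - L a) ->
  L e = 0 ->
  forall b, (forall i, reg (b i)) -> L b = 0.
Proof.
move=> ereg hexp halt hskew Le; apply: (multilinear_vanish ereg hexp) => t.
have [/injectiveP tinj|/injectivePn[i [j ij tij]]] := boolP (injectiveb (finfun t)); last first.
  by apply: (halt _ i j) => //; move: tij; rewrite !ffunE => ->.
have {}tinj : injective t by move=> x y xy; apply: tinj; rewrite !ffunE.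
have -> : (fun i => e (t i)) = (fun i => e (perm tinj i)).
  by apply/funext => i; rewrite permE.
have [ts -> ht] := prod_tpermP (perm tinj).
elim: ts ht e ereg Le {hexp} => [|[i j] ts IHts] /= ht e ereg Le.
  rewrite big_nil; have -> : (fun i => e ((1%g : {perm 'I_k}) i)) = e by apply/funext => i; rewrite perm1.
  by [].
move: ht => /andP[ij hts].
have := IHts hts _ ereg Le; set a := (fun l => e _) => La.
have := hskew a i j (fun l => ereg _) ij; rewrite La oppr0 => <-; congr L.
by apply/funext => l; rewrite /a big_cons permM.
Qed.
End Multilinear.

(** * Determinants as functions of their rows *)

Section RowDet.
Variables (F : fieldType) (N : nat).
Implicit Types (R : 'I_N -> 'rV[F]_N).

Definition row_det R : F := \det (\matrix_i R i).

Lemma row_det_linear R i : exists mu : 'cV[F]_N, forall v,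
  row_det (subst_at R i v) = (v *m mu) 0 0.
Proof.
exists (\col_j cofactor (\matrix_i R i) i j) => v.
rewrite /row_det (expand_det_row _ i) mxE; apply: eq_bigr => j _.
rewrite !mxE subst_at_eq; congr (_ * (_ * \det _)).
by apply/matrixP => a b; rewrite !mxE subst_at_neq // eq_sym neq_lift.
Qed.

Lemma row_det_alternate R i j : i != j -> R i = R j -> row_det R = 0.
Proof.
by move=> ij E; apply: (determinant_alternate ij) => l; rewrite !mxE E.
Qed.

Lemma row_det_swap R i j : i != j ->
  row_det (fun l => R (tperm i j l)) = - row_det R.
Proof.
move=> ij; rewrite /row_det.
have -> : \matrix_l R (tperm i j l) = row_perm (tperm i j) (\matrix_l R l).
  by apply/matrixP => a b; rewrite !mxE.
by rewrite row_permE det_mulmx det_perm odd_tperm ij expr1 mulN1r.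
Qed.

Lemma row_det_scale R (d : 'I_N -> F) :
  row_det (fun i => d i *: R i) = (\prod_i d i) * row_det R.
Proof.
rewrite /row_det; have -> : \matrix_i (d i *: R i) = diag_mx (\row_i d i) *m \matrix_i R i.
  by apply/matrixP => a b; rewrite mul_diag_mx !mxE.
by rewrite det_mulmx det_diag; congr (_ * _); apply: eq_bigr => i _; rewrite mxE.
Qed.

Lemma row_det_ker R (v : 'cV[F]_N) : v != 0 -> (forall i, R i *m v = 0) ->
  row_det R = 0.
Proof.
move=> vn Rv; apply/eqP; apply: contraT => dn.
have Au : \matrix_i R i \in unitmx by rewrite unitmxE unitfE.
have Av : \matrix_i R i *m v = 0.
  by apply/row_matrixP => i; rewrite row_mul rowK Rv row0.
by case/eqP: vn; rewrite -[v](mulKmx Au) Av mulmx0.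
Qed.

Lemma row_det_span R (v : 'rV[F]_N) : row_det R != 0 ->
  exists x : 'I_N -> F, v = \sum_i x i *: R i.
Proof.
move=> dn; have Au : \matrix_i R i \in unitmx by rewrite unitmxE unitfE.
exists (fun i => (v *m invmx (\matrix_i R i)) 0 i).
rewrite -[LHS](mulmxKV Au) mulmx_sum_row; apply: eq_bigr => i _.
by rewrite rowK.
Qed.

Variables (s k : nat) (e : (s + k)%N = N).

Definition stack (A : Type) (w : 'I_s -> A) (b : 'I_k -> A) : 'I_N -> A :=
  fun i => match split (cast_ord (esym e) i) with inl a => w a | inr j => b j end.

Lemma stackl (A : Type) (w : 'I_s -> A) b a :
  stack w b (cast_ord e (lshift k a)) = w a.
Proof. by rewrite /stack cast_ordK (unsplitK (inl a)). Qed.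

Lemma stackr (A : Type) (w : 'I_s -> A) b j :
  stack w b (cast_ord e (rshift s j)) = b j.
Proof. by rewrite /stack cast_ordK (unsplitK (inr j)). Qed.

Lemma stack_ind (Q : 'I_N -> Prop) :
  (forall a, Q (cast_ord e (lshift k a))) ->
  (forall j, Q (cast_ord e (rshift s j))) -> forall i, Q i.
Proof.
move=> hl hr i; rewrite -(cast_ordKV e i) -(splitK (cast_ord (esym e) i)).
by case: split.
Qed.

Lemma stack_big (A : Type) (idx : A) (op : Monoid.com_law idx) (H : 'I_N -> A) :
  \big[op/idx]_i H i = op (\big[op/idx]_a H (cast_ord e (lshift k a)))
    (\big[op/idx]_j H (cast_ord e (rshift s j))).
Proof.
rewrite (reindex (cast_ord e)); first exact: big_split_ord.
by exists (cast_ord (esym e)) => i _; rewrite ?cast_ordK ?cast_ordKV.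
Qed.

Lemma stack_subst (A : Type) (w : 'I_s -> A) b i x :
  stack w (subst_at b i x) = subst_at (stack w b) (cast_ord e (rshift s i)) x.
Proof.
apply/funext; apply: stack_ind => [a|j]; rewrite ?stackl ?stackr /subst_at.
  rewrite (inj_eq (@cast_ord_inj _ _ e)) stackl.
  by rewrite (_ : lshift k a == rshift s i = false) //; apply/eqP => /(congr1 val) /= h;
     move: (ltn_ord a); rewrite h ltnNge leq_addr.
by rewrite (inj_eq (@cast_ord_inj _ _ e)) stackr (inj_eq (@rshift_inj _ _)).
Qed.

Lemma stack_substl (A : Type) (w : 'I_s -> A) b a x :
  stack (subst_at w a x) b = subst_at (stack w b) (cast_ord e (lshift k a)) x.
Proof.
apply/funext; apply: stack_ind => [a'|j]; rewrite ?stackl ?stackr /subst_at.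
  by rewrite (inj_eq (@cast_ord_inj _ _ e)) stackl (inj_eq (@lshift_inj _ _)).
rewrite (inj_eq (@cast_ord_inj _ _ e)) stackr.
by rewrite (_ : rshift s j == lshift k a = false) //; apply/eqP => /(congr1 val) /= h;
     move: (ltn_ord a); rewrite -h ltnNge leq_addr.
Qed.

Lemma stack_tperm (A : Type) (w : 'I_s -> A) b i j :
  stack w (fun l => b (tperm i j l)) =
  (fun l => stack w b (tperm (cast_ord e (rshift s i)) (cast_ord e (rshift s j)) l)).
Proof.
have inj : injective (fun i => cast_ord e (rshift s i)).
  by move=> x y /cast_ord_inj /rshift_inj.
apply/funext; apply: stack_ind => [a|l]; rewrite ?stackl ?stackr.
  rewrite tpermD ?stackl //; rewrite (inj_eq (@cast_ord_inj _ _ e));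
    apply/eqP => /(congr1 val) /= h; move: (ltn_ord a);
    by rewrite -h ltnNge leq_addr.
by rewrite -[LHS](stackr w b) (inj_tperm _ _ _ inj).
Qed.

(** The coefficients mu are cofactors, so that w a *m mu is the expansion of a
    determinant with a repeated row. *)
Lemma stack_det_linear (w : 'I_s -> 'rV[F]_N) b i : exists mu : 'cV[F]_N,
  (forall a, w a *m mu = 0) /\
  forall v, row_det (stack w (subst_at b i v)) = (v *m mu) 0 0.
Proof.
have [mu hmu] := row_det_linear (stack w b) (cast_ord e (rshift s i)).
exists mu; split=> [a|v]; last by rewrite stack_subst.
apply/matrixP => x y; rewrite !ord1 -hmu mxE -stack_subst.
apply: (@row_det_alternate _ (cast_ord e (lshift k a)) (cast_ord e (rshift s i))).
  rewrite (inj_eq (@cast_ord_inj _ _ e)).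
  by apply/eqP => /(congr1 val) /= h; move: (ltn_ord a); rewrite h ltnNge leq_addr.
by rewrite stackl stackr subst_at_eq.
Qed.

End RowDet.

(** * Derivations of regular functions *)

Lemma mpoly_ring_ind (C : comNzRingType) (N : nat) (Q : {mpoly C[N]} -> Prop) :
  (forall c, Q c%:MP) -> (forall i, Q 'X_i) ->
  (forall f g, Q f -> Q g -> Q (f + g)) -> (forall f g, Q f -> Q g -> Q (f * g)) ->
  forall f, Q f.
Proof.
move=> QC QX QD QM f; rewrite [f]mpolyE.
have Q1 : Q 1 by rewrite -mpolyC1; apply: QC.
apply: (big_ind Q) => [||k _]; [by rewrite -mpolyC0; apply: QC | exact: QD |].
rewrite -mul_mpolyC; apply: (QM _ _ (QC _)).
rewrite mpolyXE_id; apply: (big_ind Q) => [||i _]; [exact: Q1 | exact: QM |].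
elim: (k i) => [|j IHj]; first by rewrite expr0.
by rewrite exprS; apply: QM.
Qed.

Lemma mderiv_homog (C : closedFieldType) (N d : nat) (g : {mpoly C[N]}) j :
  g \is d.-homog -> mderiv j g \is d.-1.-homog.
Proof.
move=> gd; apply/dhomogP => k; rewrite mcoeff_msupp mcoeff_mderiv => kn.
have : (k + U_(j))%MM \in msupp g.
  by rewrite mcoeff_msupp; apply: contraNneq kn => ->; rewrite mul0rn.
by move/(dhomog_mf gd); rewrite /= mdegD mdeg1 addn1 => <-.
Qed.

Lemma homog0_const (C : nzRingType) (N : nat) (g : {mpoly C[N]}) :
  g \is 0.-homog -> g = (g@_0%MM)%:MP.
Proof.
move=> gd; apply/mpolyP => k; rewrite mcoeffC.
have [->|kn] := eqVneq k 0%MM; first by rewrite mulr1.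
by rewrite mulr0; apply: dhomog_nemf_coeff gd _; rewrite /= mdeg_eq0.
Qed.

Lemma grad_scale (C : closedFieldType) (N d : nat) (g : {mpoly C[N]}) (p : 'I_N -> C) l :
  g \is d.-homog -> l *: grad (fun i => l * p i) g = l ^+ d *: grad p g.
Proof.
move=> gd; case: d gd => [|d] gd; last first.
  apply/rowP => j; rewrite !mxE (meval_homog _ _ (mderiv_homog j gd)) /=.
  by rewrite exprS mulrA.
by rewrite (homog0_const gd) !gradC !scaler0.
Qed.

Lemma entryZ (C : comNzRingType) (a : C) (A : 'M[C]_1) : (a *: A) 0 0 = a * A 0 0.
Proof. by rewrite mxE. Qed.

Lemma entryD (C : comNzRingType) (A B : 'M[C]_1) : (A + B) 0 0 = A 0 0 + B 0 0.
Proof. by rewrite mxE. Qed.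

Lemma entryB (C : comNzRingType) (A B : 'M[C]_1) : (A - B) 0 0 = A 0 0 - B 0 0.
Proof. by rewrite !mxE. Qed.

Section Regular.
Variables (C : closedFieldType) (n : nat).
Implicit Types (U V : set (coords C n)) (p : coords C n).

Lemma dhomogC (N : nat) (a : C) : (a%:MP : {mpoly C[N]}) \is 0.-homog.
Proof. by rewrite -[a%:MP]mulr1 mul_mpolyC dhomogZ // dhomog1. Qed.

Lemma regular_cst U a : regular_on U (fun=> a).
Proof.
move=> p Up; exists 0%N, 0%N, a%:MP, 1.
split; rewrite ?dhomog1 ?dhomogC ?meval1 ?oner_neq0 //.
by move=> q _ _; rewrite mevalC meval1 divr1.
Qed.

Lemma regular_D U f g : regular_on U f -> regular_on U g ->
  regular_on U (fun q => f q + g q).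
Proof.
move=> hf hg p Up.
have [d1 [e1 [g1 [h1 [E1 g1h h1h h1p f1]]]]] := hf p Up.
have [d2 [e2 [g2 [h2 [E2 g2h h2h h2p f2]]]]] := hg p Up.
move: E1 E2; rewrite !addr0 => -[E1] [E2]; subst d1 d2.
exists (e1 + e2)%N, (e1 + e2)%N, (g1 * h2 + g2 * h1), (h1 * h2); split.
- by rewrite addr0.
- by rewrite [g2 * h1]mulrC rpredD ?dhomogM.
- exact: dhomogM.
- by rewrite mevalM mulf_neq0.
move=> q Uq; rewrite mevalM mulf_eq0 negb_or => /andP[h1q h2q].
by rewrite f1 // f2 // mevalD !mevalM addf_div.
Qed.

Lemma regular_M U f g : regular_on U f -> regular_on U g ->
  regular_on U (fun q => f q * g q).
Proof.
move=> hf hg p Up.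
have [d1 [e1 [g1 [h1 [E1 g1h h1h h1p f1]]]]] := hf p Up.
have [d2 [e2 [g2 [h2 [E2 g2h h2h h2p f2]]]]] := hg p Up.
move: E1 E2; rewrite !addr0 => -[E1] [E2]; subst d1 d2.
exists (e1 + e2)%N, (e1 + e2)%N, (g1 * g2), (h1 * h2); split.
- by rewrite addr0.
- exact: dhomogM.
- exact: dhomogM.
- by rewrite mevalM mulf_neq0.
move=> q Uq; rewrite mevalM mulf_eq0 negb_or => /andP[h1q h2q].
by rewrite f1 // f2 // !mevalM mulf_div.
Qed.

Lemma regular_sub U V f : V `<=` U -> regular_on U f -> regular_on V f.
Proof.
move=> VU hf p Vp; have [dg [dh [g [h [E gh hh hp fE]]]]] := hf p (VU _ Vp).
by exists dg, dh, g, h; split=> // q Vq; apply: fE; apply: VU.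
Qed.

(** Gradients are computed from an expression, so regular functions are handled
    through pairs (g, h) of forms of equal degree standing for g / h. *)
Definition frac_fun (t : {mpoly C[n.+1]} * {mpoly C[n.+1]}) : coords C n -> C :=
  fun q => t.1.@[q] / t.2.@[q].

Definition frac_on V (t : {mpoly C[n.+1]} * {mpoly C[n.+1]}) :=
  exists d, [/\ t.1 \is d.-homog, t.2 \is d.-homog & forall q, V q -> t.2.@[q] != 0].

Definition frac_grad p (t : {mpoly C[n.+1]} * {mpoly C[n.+1]}) : 'rV[C]_n.+1 :=
  (t.2.@[p] ^- 2) *: (t.2.@[p] *: grad p t.1 - t.1.@[p] *: grad p t.2).

Definition chart_coord (c j : 'I_n.+1) : {mpoly C[n.+1]} * {mpoly C[n.+1]} := ('X_j, 'X_c).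

Lemma frac_regular V t : frac_on V t -> regular_on V (frac_fun t).
Proof.
by move=> [d [h1 h2 h]] p Vp; exists d, d, t.1, t.2; split=> //; [rewrite addr0 | apply: h].
Qed.

Lemma var_homog (j : 'I_n.+1) : ('X_j : {mpoly C[n.+1]}) \is 1.-homog.
Proof. by rewrite dhomogX; apply/eqP; exact: mdeg1. Qed.

Lemma frac_coord V c j : (forall q, V q -> q c != 0) -> frac_on V (chart_coord c j).
Proof.
move=> hc; exists 1%N; split; try exact: var_homog.
by move=> q Vq; rewrite mevalXU; apply: hc.
Qed.

Lemma frac_grad_coord p c j : frac_grad p (chart_coord c j) =
  p c ^- 2 *: (p c *: delta_mx 0 j - p j *: delta_mx 0 c).
Proof. by rewrite /frac_grad /= !mevalXU !gradX. Qed.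

(** A quotient of forms of equal degree is constant along the line through p. *)
Lemma frac_grad_pt V p t : frac_on V t -> V p -> frac_grad p t *m pt_col p = 0.
Proof.
move=> [d [h1 h2 h]] Vp; rewrite /frac_grad -scalemxAl mulmxBl -!scalemxAl.
rewrite (grad_euler _ h1) (grad_euler _ h2) !scale_scalar_mx -raddfB /=.
rewrite scale_scalar_mx; apply/matrixP => i j; rewrite !mxE.
by rewrite [X in _ * X]( _ : _ = 0) ?mulr0 ?mul0rn //; ring.
Qed.

Definition derivation_at V p (E : (coords C n -> C) -> C) :=
  [/\ forall f g, regular_on V f -> regular_on V g ->
        (forall q, V q -> f q = g q) -> E f = E g,
      forall a f g, regular_on V f -> regular_on V g ->
        E (fun q => a * f q + g q) = a * E f + E g &
      forall f g, regular_on V f -> regular_on V g ->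
        E (fun q => f q * g q) = f p * E g + g p * E f].

Lemma derivation_cst V p E a : derivation_at V p E -> E (fun=> a) = 0.
Proof.
move=> [ext lin leib]; have r := @regular_cst V.
have E0 : E (fun=> 0) = 0.
  have := lin 1 _ _ (r 0) (r 0).
  have -> : (fun=> 1 * 0 + 0) = (fun=> 0) :> (coords C n -> C).
    by apply/funext => q; rewrite mulr0 addr0.
  by rewrite mul1r => /eqP; rewrite -subr_eq0 opprD addrA subrr sub0r oppr_eq0 => /eqP.
have E1 : E (fun=> 1) = 0.
  have := leib _ _ (r 1) (r 1).
  have -> : (fun=> 1 * 1) = (fun=> 1) :> (coords C n -> C).
    by apply/funext => q; rewrite mulr1.
  by rewrite !mul1r => /eqP; rewrite -subr_eq0 opprD addrA subrr sub0r oppr_eq0 => /eqP.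
have := lin a _ _ (r 1) (r 0).
have -> : (fun=> a * 1 + 0) = (fun=> a) :> (coords C n -> C).
  by apply/funext => q; rewrite mulr1 addr0.
by rewrite E1 E0 mulr0 addr0.
Qed.

Section Chart.
Variables (V : set (coords C n)) (p : coords C n) (c : 'I_n.+1).
Variable E : (coords C n -> C) -> C.
Hypotheses (Vp : V p) (hc : forall q, V q -> q c != 0).
Hypothesis hE : derivation_at V p E.

Let pc : p c != 0. Proof. exact: hc. Qed.
Let dehom (g : {mpoly C[n.+1]}) : coords C n -> C :=
  fun q => g.@[fun i => (q c)^-1 * q i].
Let nu : 'cV[C]_n.+1 := \col_j E (frac_fun (chart_coord c j)).
Definition chart_col : 'cV[C]_n.+1 := p c *: nu.

Let dehom_deriv g : regular_on V (dehom g) /\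
  E (dehom g) = (grad (fun i => (p c)^-1 * p i) g *m nu) 0 0.
Proof.
have [ext lin leib] := hE.
elim/mpoly_ring_ind: g => [a|j|g h [rg Eg] [rh Eh]|g h [rg Eg] [rh Eh]].
- have -> : dehom a%:MP = (fun=> a) by apply/funext => q; rewrite /dehom mevalC.
  split; first exact: regular_cst.
  by rewrite (derivation_cst a hE) gradC mul0mx mxE.
- have -> : dehom 'X_j = frac_fun (chart_coord c j).
    by apply/funext => q; rewrite /dehom /frac_fun /= !mevalXU mulrC.
  split; first by apply: frac_regular; apply: frac_coord.
  by rewrite gradX -rowE !mxE.
- have -> : dehom (g + h) = (fun q => 1 * dehom g q + dehom h q).
    by apply/funext => q; rewrite /dehom mevalD mul1r.
  split; last by rewrite lin // Eg Eh gradD mulmxDl [RHS]mxE mul1r.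
  apply: regular_D => //.
  by have -> : (fun q => 1 * dehom g q) = dehom g by apply/funext => q; rewrite mul1r.
- have -> : dehom (g * h) = (fun q => dehom g q * dehom h q).
    by apply/funext => q; rewrite /dehom mevalM.
  split; first exact: regular_M.
  by rewrite leib // Eg Eh gradM mulmxDl -!scalemxAl addrC entryD !entryZ.
Qed.

(** A derivation at p is determined by its values on the coordinates of a
    chart: with b = g / h, apply it to g = b h after dehomogenizing. *)
Lemma chain_rule t : frac_on V t -> E (frac_fun t) = (frac_grad p t *m chart_col) 0 0.
Proof.
move=> [d [h1 h2 h]]; have [ext lin leib] := hE.
have rt : regular_on V (frac_fun t) by apply: frac_regular; exists d.
have [r1 E1] := dehom_deriv t.1; have [r2 E2] := dehom_deriv t.2.
have dehomE g q : g \is d.-homog -> dehom g q = (q c)^-1 ^+ d * g.@[q].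
  by move=> gd; rewrite /dehom (meval_homog _ _ gd).
have : E (dehom t.1) = E (fun q => frac_fun t q * dehom t.2 q).
  apply: ext => // [|q Vq]; first exact: regular_M.
  rewrite !dehomE // /frac_fun; field.
  by rewrite h // hc.
rewrite leib // E1 E2 dehomE // /frac_fun.
have gE g : g \is d.-homog -> (grad (fun i => (p c)^-1 * p i) g *m nu) 0 0
    = (p c)^-1 ^+ d * (grad p g *m chart_col) 0 0.
  move=> gd; have := grad_scale p (p c)^-1 gd.
  move/(congr1 (fun x : 'rV_n.+1 => (x *m chart_col) 0 0)).
  rewrite -!scalemxAl !entryZ => <-.
  by rewrite /chart_col -scalemxAr entryZ mulrA mulVf ?mul1r.
rewrite !gE //.
rewrite /frac_grad -!scalemxAl mulmxBl -!scalemxAl.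
rewrite !(entryZ, entryB); set G := (grad p t.1 *m _) 0 0; set H := (grad p t.2 *m _) 0 0.
set x := E _; set l := _ ^+ d => eq.
have ln : l != 0 by rewrite expf_neq0 // invr_eq0.
have t2 : t.2.@[p] != 0 by apply: h.
have -> : G = t.1.@[p] / t.2.@[p] * H + t.2.@[p] * x.
  by apply: (mulfI ln); rewrite eq; ring.
by field.
Qed.

Lemma chart_col_pt : delta_mx 0 c *m chart_col = 0 :> 'M_1.
Proof.
apply/matrixP => i j; rewrite !ord1 /chart_col -scalemxAr -rowE !mxE.
have [ext _ _] := hE.
rewrite (ext _ (fun=> 1)); first by rewrite (derivation_cst _ hE) mulr0.
- by apply: frac_regular; apply: frac_coord.
- exact: regular_cst.
- by move=> q Vq; rewrite /frac_fun /= mulfV // mevalXU; apply: hc.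
Qed.

Lemma chart_col_tangent f d : f \is d.-homog -> (forall q, V q -> f.@[q] = 0) ->
  grad p f *m chart_col = 0.
Proof.
move=> fd f0; apply/matrixP => i j; rewrite !ord1 [RHS]mxE.
have ht : frac_on V (f, 'X_c ^+ d).
  exists d; split=> //= [|q Vq]; first by have := dhomogMn d (var_homog c); rewrite mul1n.
  by rewrite rmorphXn /= mevalXU expf_neq0 // hc.
have := chain_rule ht; have [ext _ _] := hE.
rewrite (ext _ (fun=> 0)); last 3 first.
- exact: frac_regular.
- exact: regular_cst.
- by move=> q Vq; rewrite /frac_fun /= f0 // mul0r.
rewrite (derivation_cst _ hE) /frac_grad /= f0 // scale0r subr0 scalerA -scalemxAl mxE.
move/esym/eqP; rewrite mulf_eq0 mulf_eq0 invr_eq0 expf_eq0 /=.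
by rewrite rmorphXn /= mevalXU expf_eq0 (negPf pc) !andbF /= => /eqP.
Qed.
End Chart.
End Regular.

(** * Forms of top degree on a complete intersection *)

Section Forms.
Variables (C : closedFieldType) (n k : nat) (s : int) (X : set (coords C n)).
Variable D : set (coords C n) -> ('I_k -> coords C n -> C) -> coords C n -> C.
Hypothesis hD : form_morphism s X D.
Variables (V : set (coords C n)) (p : coords C n).
Hypotheses (Vo : zopen_in X V) (Vp : V p).

Lemma form_derivation a i : (forall j, regular_on V (a j)) ->
  derivation_at V p (fun f => D V (subst_at a i f) p).
Proof.
move=> ha; split=> [f g hf hg fg|b f g hf hg|f g hf hg].
- apply: (form_res hD Vo Vo) => //; try exact: subst_at_all.
  by move=> j q Vq; rewrite /subst_at; case: eqP => // _; apply: fg.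
- exact: form_linear hD _ _ _ _ _ _ Vo ha hf hg _ Vp.
- exact: form_leibniz hD _ _ _ _ _ Vo ha hf hg _ Vp.
Qed.

(** Polarization of the alternation in the slots i and j. *)
Lemma form_skew a i j : (forall l, regular_on V (a l)) -> i != j ->
  D V (fun l => a (tperm i j l)) p = - D V a p.
Proof.
move=> ha ij; set f := a i; set g := a j.
have ji : j != i by rewrite eq_sym.
have hf : regular_on V f by exact: ha.
have hg : regular_on V g by exact: ha.
pose h := fun q => 1 * f q + g q.
have hh : regular_on V h.
  apply: (@regular_D _ _ V (fun q => 1 * f q) g); last exact: ha.
  by apply: regular_M; [exact: regular_cst | exact: ha].
pose b x y := subst_at (subst_at a i x) j y.
have hb x y : regular_on V x -> regular_on V y -> forall l, regular_on V (b x y l).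
  by move=> hx hy; do 2 apply: (@subst_at_all _ _ (regular_on V)) => //.
have b0 x : regular_on V x -> D V (b x x) p = 0.
  move=> hx; apply: (form_alternating hD Vo (hb _ _ hx hx) ij) => // q _.
  by rewrite /b subst_at_neq // !subst_at_eq.
have lin_r x : regular_on V x ->
    D V (b x h) p = D V (b x f) p + D V (b x g) p.
  move=> hx; rewrite -[D V (b x f) p]mul1r.
  apply: (@form_linear _ _ _ _ _ _ hD V (subst_at a i x) j 1 f g) => //.
  exact: (@subst_at_all _ _ (regular_on V)).
have lin_l y : regular_on V y ->
    D V (b h y) p = D V (b f y) p + D V (b g y) p.
  move=> hy; rewrite -[D V (b f y) p]mul1r /b !(subst_atC _ _ _ ij).
  apply: (@form_linear _ _ _ _ _ _ hD V (subst_at a j y) i 1 f g) => //.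
  exact: (@subst_at_all _ _ (regular_on V)).
have := b0 h hh; rewrite lin_r // !lin_l // !b0 // add0r addr0.
have -> : b f g = a by rewrite /b !subst_at_id.
have -> : b g f = (fun l => a (tperm i j l)).
  apply/funext => l; rewrite /b /subst_at.
  case: tpermP => [->|->|/eqP li /eqP lj]; rewrite ?eqxx ?(negPf ij) //.
  by rewrite (negPf li) (negPf lj).
by move=> /eqP; rewrite addr_eq0 => /eqP ->.
Qed.

Variables (r : nat) (f : 'I_r -> {mpoly C[n.+1]}) (d : 'I_r -> nat).
Hypotheses (fd : forall i, f i \is (d i).-homog) (fX : forall i q, X q -> (f i).@[q] = 0).
Variable e : (r.+1 + k = n.+1)%N.
Let XV : V `<=` X. Proof. by case: Vo => Z _ -> q []. Qed.

Definition conormal_rows (u : 'rV[C]_n.+1) (a : 'I_r.+1) : 'rV[C]_n.+1 :=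
  if unlift ord_max a is Some l then grad p (f l) else u.

(** Up to the factor u(p), the volume of k covectors on the tangent space of X
    at p: the determinant of the gradients of the equations, of u, and of the k
    covectors. *)
Definition vol (u : 'rV[C]_n.+1) (b : 'I_k -> {mpoly C[n.+1]} * {mpoly C[n.+1]}) : C :=
  row_det (stack e (conormal_rows u) (fun i => frac_grad p (b i))).

Lemma vol_linear u b i : exists mu : 'cV[C]_n.+1,
  (forall a, conormal_rows u a *m mu = 0) /\
  forall t, vol u (subst_at b i t) = (frac_grad p t *m mu) 0 0.
Proof.
have [mu [hw hmu]] :=
  stack_det_linear e (conormal_rows u) (fun i => frac_grad p (b i)) i.
by exists mu; split=> // t; rewrite /vol subst_at_comp hmu.
Qed.

Lemma conormal_rows_eq u : conormal_rows u ord_max = u.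
Proof. by rewrite /conormal_rows unlift_none. Qed.

Lemma conormal_rows_grad u l : conormal_rows u (lift ord_max l) = grad p (f l).
Proof. by rewrite /conormal_rows liftK. Qed.

(** Both sides are alternating in the covectors, linear through the same
    gradients, and blind to the conormal rows: the space of such functions is a
    line because the tangent space has dimension k. *)
Lemma forms_proportional c E b :
  (forall q, V q -> q c != 0) ->
  (forall i, frac_on V (E i)) -> (forall i, frac_on V (b i)) ->
  vol (delta_mx 0 c) E != 0 ->
  D V (fun i => frac_fun (b i)) p * vol (delta_mx 0 c) E =
  D V (fun i => frac_fun (E i)) p * vol (delta_mx 0 c) b.
Proof.
move=> hc Eon bon volE; set u := delta_mx 0 c in volE *.
pose M b := D V (fun i => frac_fun (b i)) p.
pose L b := M b * vol u E - M E * vol u b.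
suff Lb : L b = 0 by apply/eqP; rewrite -subr_eq0; apply/eqP.
have reg (a : 'I_k -> {mpoly C[n.+1]} * {mpoly C[n.+1]}) :
    (forall j, frac_on V (a j)) -> forall j, regular_on V (frac_fun (a j)).
  by move=> ha j; apply: frac_regular.
have L_linear a i : (forall j, frac_on V (a j)) -> exists mu : 'cV[C]_n.+1,
    (forall l, conormal_rows u l *m mu = 0) /\
    forall t, frac_on V t -> L (subst_at a i t) = (frac_grad p t *m mu) 0 0.
  move=> ha; have [mu [hmu volmu]] := vol_linear u a i.
  have hE := form_derivation i (reg _ ha).
  pose nu := chart_col p c (fun g => D V (subst_at (fun j => frac_fun (a j)) i g) p).
  have f_nu l : grad p (f l) *m nu = 0.
    by apply: (chart_col_tangent Vp hc hE (fd l)) => q /XV; apply: fX.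
  have u_nu : u *m nu = 0 by exact: (chart_col_pt hc hE).
  have M_nu t : frac_on V t -> M (subst_at a i t) = (frac_grad p t *m nu) 0 0.
    by move=> ht; rewrite -(chain_rule Vp hc hE ht) /M subst_at_comp.
  clearbody nu; exists (vol u E *: nu - M E *: mu); split=> [l|t ht].
    rewrite mulmxBr -!scalemxAr hmu scaler0 subr0.
    case: (unliftP ord_max l) => [l' ->|->].
      by rewrite conormal_rows_grad f_nu scaler0.
    by rewrite conormal_rows_eq u_nu scaler0.
  rewrite /L volmu mulmxBr -!scalemxAr entryB !entryZ M_nu //.
  by rewrite mulrC.
apply: (@alternating_vanish C _ (frac_on V) k L E) => //.
- move=> t i ht.
  have [x xE] := row_det_span (frac_grad p t) volE.
  exists (fun j => x (cast_ord e (rshift r.+1 j))) => a ha.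
  have [mu [hmu Lmu]] := L_linear a i ha.
  rewrite Lmu // xE (stack_big e) /= mulmxDl !mulmx_suml entryD.
  rewrite big1 ?mxE ?add0r; last by move=> l _; rewrite stackl -scalemxAl hmu scaler0.
  rewrite summxE; apply: eq_bigr => j _.
  by rewrite stackr -scalemxAl entryZ -Lmu.
- move=> a i j ha ij aij; rewrite /L.
  have -> : M a = 0.
    by apply: (form_alternating hD Vo (reg _ ha) ij _ Vp) => q _; rewrite aij.
  rewrite mul0r sub0r /vol.
  rewrite (@row_det_alternate _ _ _ (cast_ord e (rshift r.+1 i)) (cast_ord e (rshift r.+1 j))).
  + by rewrite mulr0 oppr0.
  + by rewrite (inj_eq (@cast_ord_inj _ _ e)) (inj_eq (@rshift_inj _ _)).
  + by rewrite !stackr aij.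
- move=> a i j ha ij; rewrite /L /M.
  rewrite (form_skew (a := fun l => frac_fun (a l)) (reg _ ha) ij) /vol.
  rewrite (stack_tperm e (conormal_rows u) (fun l => frac_grad p (a l))) row_det_swap.
    by rewrite mulNr mulrN opprD.
  by rewrite (inj_eq (@cast_ord_inj _ _ e)) (inj_eq (@rshift_inj _ _)).
- by rewrite /L subrr.
Qed.

Lemma vol_row_linear b : exists mu : 'cV[C]_n.+1,
  forall u, vol u b = (u *m mu) 0 0.
Proof.
have [mu hmu] := row_det_linear (stack e (conormal_rows 0) (fun i => frac_grad p (b i)))
  (cast_ord e (lshift k ord_max)).
exists mu => u; rewrite -hmu -stack_substl /vol; congr row_det; congr (stack e).
apply/funext => a; rewrite /subst_at /conormal_rows.
by case: unliftP => [l ->|->]; rewrite ?eqxx // eq_sym (negPf (neq_lift _ _)).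
Qed.

(** Apart from u, the rows of vol are orthogonal to the point p. *)
Lemma vol_change c u u' b : p c != 0 -> (forall i, frac_on V (b i)) ->
  vol u b * (u' *m pt_col p) 0 0 = vol u' b * (u *m pt_col p) 0 0.
Proof.
move=> pc bon; have Xp := XV Vp.
have [mu hmu] := vol_row_linear b.
pose x := (u *m pt_col p) 0 0; pose x' := (u' *m pt_col p) 0 0.
have : vol (x' *: u - x *: u') b = 0.
  apply: (@row_det_ker _ _ _ (pt_col p)).
    by apply/eqP => /matrixP /(_ c 0) /eqP; rewrite !mxE (negPf pc).
  apply: (stack_ind (e := e)) => [a|j]; rewrite ?stackl ?stackr; last exact: frac_grad_pt.
  case: (unliftP ord_max a) => [l ->|->].
    by rewrite conormal_rows_grad (grad_euler _ (fd l)) fX // mulr0 raddf0.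
  rewrite conormal_rows_eq mulmxBl -!scalemxAl.
  by apply/matrixP => i j; rewrite !ord1 entryB !entryZ [RHS]mxE mulrC subrr.
rewrite hmu mulmxBl -!scalemxAl entryB !entryZ -!hmu => /eqP.
by rewrite subr_eq0 ![_ * vol _ _]mulrC => /eqP.
Qed.

End Forms.

Section Minors.
Variables (C : closedFieldType) (n k r : nat).
Variables (f : 'I_r -> {mpoly C[n.+1]}) (d : 'I_r -> nat) (e : (r.+1 + k = n.+1)%N).
Hypothesis fd : forall i, f i \is (d i).-homog.
Implicit Types (p : coords C n) (c : 'I_n.+1) (t : 'I_k -> 'I_n.+1).

Definition minor_rows c t : 'I_n.+1 -> 'rV[{mpoly C[n.+1]}]_n.+1 :=
  stack e (fun a => if unlift ord_max a is Some l then \row_j mderiv j (f l)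
                    else delta_mx 0 c)
    (fun i => 'X_c *: delta_mx 0 (t i) - 'X_(t i) *: delta_mx 0 c).

(** The volume of the coordinates x_t / x_c with denominators cleared. *)
Definition minor c t : {mpoly C[n.+1]} := \det (\matrix_i minor_rows c t i).

Lemma minorE p c t : p c != 0 -> (minor c t).@[p] =
  p c ^+ (2 * k) * vol p f e (delta_mx 0 c) (fun i => chart_coord C c (t i)).
Proof.
move=> pc; pose s := stack e (fun=> 1) (fun=> p c ^+ 2).
have -> : p c ^+ (2 * k) = \prod_i s i.
  rewrite (stack_big e) /= big1 ?mul1r; last by move=> a _; rewrite /s stackl.
  under eq_bigr do rewrite /s stackr.
  by rewrite prodr_const card_ord exprM.
rewrite /vol -row_det_scale /minor /row_det -det_map_mx /=; congr (\det _).
apply/matrixP => i j; rewrite !mxE; move: i; apply: (stack_ind (e := e)) => [a|i].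
  rewrite /minor_rows /s !stackl mul1r /conormal_rows.
  case: (unlift _ _) => [l|]; first by rewrite !mxE.
  by rewrite !mxE; case: (_ && _); rewrite ?meval1 ?meval0.
rewrite /minor_rows /s !stackr frac_grad_coord !mxE.
rewrite mevalB !mevalM !mevalXU mulrA mulfV ?expf_neq0 // mul1r.
by do 2 case: (_ && _); rewrite ?meval1 ?meval0.
Qed.

Lemma det_homog N (A : 'M[{mpoly C[n.+1]}]_N) (s : 'I_N -> nat) :
  (forall i j, A i j \is (s i).-homog) -> \det A \is (\sum_i s i).-homog.
Proof.
move=> hA; apply: rpred_sum => g _.
have hprod : \prod_i A i (g i) \is (\sum_i s i).-homog.
  by elim/big_ind2: _ => [|x a y b hx hy|i _]; [exact: dhomog1 | exact: dhomogM | exact: hA].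
by rewrite -signr_odd; case: (odd _); rewrite ?expr0 ?mul1r // expr1 mulN1r rpredN.
Qed.

Lemma minor_homog c t : minor c t \is (\sum_l (d l).-1 + k)%N.-homog.
Proof.
pose s := stack e (fun a : 'I_r.+1 => if unlift ord_max a is Some l then (d l).-1 else 0)%N
  (fun=> 1%N).
have -> : (\sum_l (d l).-1 + k = \sum_i s i)%N.
  rewrite (stack_big e) /=; congr (_ + _)%N; last first.
    by under eq_bigr do rewrite /s stackr; rewrite sum1_card card_ord.
  rewrite big_ord_recr /= /s stackl unlift_none addn0; apply: eq_bigr => l _.
  rewrite stackl; have -> : widen_ord (leqnSn r) l = lift ord_max l.
    by apply: val_inj; rewrite /= /bump leqNgt ltn_ord.
  by rewrite liftK.
apply: det_homog => i j; rewrite mxE; move: i; apply: (stack_ind (e := e)) => [a|i].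
  rewrite /minor_rows /s !stackl; case: (unlift _ _) => [l|]; rewrite mxE.
    exact: mderiv_homog.
  by case: (_ && _); [exact: dhomog1 | exact: dhomog0].
rewrite /minor_rows /s !stackr !mxE.
by apply: rpredB; case: (_ && _);
  rewrite ?mulr1 ?mulr0 ?dhomog0 // var_homog.
Qed.

(** Were all the minors zero at p, the volume would vanish on all k-tuples of
    covectors, whereas the gradients and the coordinate x_c can be completed to a
    basis. *)
Lemma exists_minor p c : p c != 0 -> (forall l, (f l).@[p] = 0) ->
  \rank (\matrix_(i < r) grad p (f i)) = r -> exists t, (minor c t).@[p] != 0.
Proof.
move=> pc fp rk; apply: contrapT => hno.
pose u : 'rV[C]_n.+1 := delta_mx 0 c.
pose w := conormal_rows p f u.
pose L (b : 'I_k -> 'rV[C]_n.+1) := row_det (stack e w b).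
have L0 b : L b = 0.
  pose y j := frac_grad p (chart_coord C c j).
  apply: (@multilinear_vanish C _ (fun=> True) k L _ y) => //.
    move=> v i _; exists (fun j => p c * v 0 j) => a _.
    have [mu [hmu Lmu]] := stack_det_linear e w a i.
    rewrite /L Lmu; under eq_bigr do rewrite Lmu.
    have y_mu j : y j *m mu = (p c)^-1 *: (delta_mx 0 j *m mu).
      have u_mu : u *m mu = 0 by rewrite -(hmu ord_max) /w conormal_rows_eq.
      rewrite /y frac_grad_coord -scalemxAl mulmxBl -!scalemxAl u_mu scaler0 subr0.
      by rewrite scalerA expr2 invfM mulfVK.
    rewrite {1}[v]matrix_sum_delta big_ord1 mulmx_suml summxE; apply: eq_bigr => j _.
    by rewrite y_mu -scalemxAl !entryZ; field.
  move=> t; apply/eqP; apply: contraT => tn; case: hno; exists t.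
  by rewrite minorE // mulf_neq0 // expf_neq0.
pose W := \matrix_a w a.
have Wfree : row_free W.
  apply: inj_row_free => x xW.
  have E : (\row_l x 0 (widen_ord (leqnSn r) l)) *m (\matrix_l grad p (f l)) + x 0 ord_max *: u = 0.
    rewrite -xW [RHS]mulmx_sum_row big_ord_recr rowK mulmx_sum_row /=; congr (_ + _ *: _).
      apply: eq_bigr => l _; rewrite !rowK mxE.
      have -> : widen_ord (leqnSn r) l = lift ord_max l.
        by apply: val_inj; rewrite /= /bump leqNgt ltn_ord.
      by rewrite /w conormal_rows_grad.
    by rewrite /w conormal_rows_eq.
  have x0 : x 0 ord_max = 0.
    have := congr1 (fun v : 'rV_n.+1 => (v *m pt_col p) 0 0) E.
    rewrite mul0mx mulmxDl -mulmxA entryD.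
    have -> : (\matrix_l grad p (f l)) *m pt_col p = 0.
      apply/row_matrixP => l; rewrite row_mul rowK (grad_euler _ (fd l)) fp mulr0 row0.
      by rewrite raddf0.
    rewrite mulmx0 -scalemxAl entryZ -rowE !mxE add0r => /eqP.
    by rewrite mulf_eq0 (negPf pc) orbF => /eqP.
  move: E; rewrite x0 scale0r addr0 => E.
  have Jfree : row_free (\matrix_l grad p (f l)) by rewrite /row_free rk.
  have xl : \row_l x 0 (widen_ord (leqnSn r) l) = 0.
    by apply: (row_free_inj Jfree); rewrite E mul0mx.
  apply/rowP => a; rewrite [RHS]mxE; case: (unliftP ord_max a) => [l ->|->//].
  have := congr1 (fun v : 'rV_r => v 0 l) xl; rewrite !mxE => <-.
  by congr (x 0 _); apply: val_inj; rewrite /= /bump leqNgt ltn_ord.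
have rkC : \rank (W^C)%MS = k by rewrite mxrank_compl (eqP Wfree) -e addKn.
pose b j := row (cast_ord (esym rkC) j) (row_base (W^C)%MS).
have := L0 b; rewrite /L /row_det; set A := \matrix_i _.
have rowA_w a : w a = row (cast_ord e (lshift k a)) A by rewrite rowK stackl.
have rowA_b j : b j = row (cast_ord e (rshift r.+1 j)) A by rewrite rowK stackr.
have Afull : row_full A.
  rewrite -sub1mx (submx_trans (B := (W + W^C)%MS)) //.
    by rewrite sub1mx addsmx_compl_full.
  rewrite addsmx_sub; apply/andP; split.
    by apply/row_subP => a; rewrite rowK rowA_w row_sub.
  rewrite -(eq_row_base (W^C)%MS); apply/row_subP => i.
  have -> : row i (row_base (W^C)%MS) = b (cast_ord rkC i) by rewrite /b cast_ordK.
  by rewrite rowA_b row_sub.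
move: Afull; rewrite row_full_unit unitmxE unitfE => /negPf An.
by move/eqP; rewrite An.
Qed.
End Minors.

(** * The residue section *)

Lemma residue_algebra (C : fieldType) (k : nat) (a b x y z q q' m m' : C) :
  q != 0 -> q' != 0 -> x != 0 -> z != 0 ->
  b * x = a * y -> y * q' = z * q -> m = q ^+ (2 * k) * x -> m' = q' ^+ (2 * k) * z ->
  a * q ^+ (2 * k + 1) / m = b * q' ^+ (2 * k + 1) / m'.
Proof.
move=> qn q'n xn zn E1 E2 -> ->; rewrite !addn1 !exprS.
have -> : b = a * y / x by rewrite -E1 mulfK.
have -> : y = z * q / q' by rewrite -E2 mulfK.
by field; rewrite ?qn ?q'n ?xn ?zn ?expf_neq0.
Qed.

Section Residue.
Variables (C : closedFieldType) (n k r : nat) (s : int) (X : set (coords C n)).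
Variable D : set (coords C n) -> ('I_k -> coords C n -> C) -> coords C n -> C.
Hypothesis (hD : form_morphism s X D) (Xirr : irreducible_closed X).
Variables (f : 'I_r -> {mpoly C[n.+1]}) (d : 'I_r -> nat) (e : (r.+1 + k = n.+1)%N).
Hypotheses (fd : forall i, f i \is (d i).-homog) (fX : forall i q, X q -> (f i).@[q] = 0).

Let Xpr : X `<=` @projective_space C n.
Proof. by case: Xirr => h _ _; exact: zclosed_proj. Qed.

Definition nonzero_dom (g : {mpoly C[n.+1]}) : set (coords C n) :=
  [set q | X q /\ g.@[q] != 0].

Let nonzero_open m g : g \is m.-homog -> zopen_in X (nonzero_dom g).
Proof. exact: zopen_nonzero. Qed.

Let chart := ('I_n.+1 * {ffun 'I_k -> 'I_n.+1})%type.
Implicit Types ct : chart.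

Let tuple_of ct : 'I_k -> {mpoly C[n.+1]} * {mpoly C[n.+1]} :=
  fun i => chart_coord C ct.1 (ct.2 i).

Let value ct q := D (nonzero_dom 'X_(ct.1)) (fun i => frac_fun (tuple_of ct i)) q.

Let good q ct := (q ct.1 != 0) && ((minor f e ct.1 ct.2).@[q] != 0).

Let residue_at ct q := value ct q * q ct.1 ^+ (2 * k + 1) / (minor f e ct.1 ct.2).@[q].

(** The quotient of the form D by the volume form of X, computed in any chart
    and with any k of its coordinates that are independent on X. *)
Definition residue q : C := if [pick ct | good q ct] is Some ct then residue_at ct q else 0.

Definition residue_dom : set (coords C n) := [set q | X q /\ exists ct, good q ct].

Lemma residue_dom_open : zopen_in X residue_dom.
Proof.
pose G ct := 'X_(ct.1) * minor f e ct.1 ct.2.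
exists [set q | @projective_space C n q /\ forall ct, (G ct).@[q] = 0].
  exists (range G); split.
    move=> _ [ct _ <-]; eexists; apply: dhomogM; first exact: var_homog.
    exact: minor_homog fd _ _.
  apply/seteqP; split=> q [pr h]; split=> //; first by move=> _ [ct _ <-].
  by move=> ct; apply: h; exists ct.
have GE ct q : ((G ct).@[q] != 0) = good q ct.
  by rewrite mevalM mevalXU mulf_eq0 negb_or.
apply/seteqP; split=> q [Xq h]; split=> //.
  by case: h => ct; rewrite -GE => /eqP h [_ /(_ ct)].
apply: contrapT => nh; apply: h; split; first exact: Xpr.
by move=> ct; apply/eqP; apply: contraT; rewrite GE => h; case: nh; exists ct.
Qed.

Let tuple_on V ct : V `<=` nonzero_dom 'X_(ct.1) -> forall i, frac_on V (tuple_of ct i).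
Proof. by move=> VX i; apply: frac_coord => q /VX [_]; rewrite mevalXU. Qed.

Let value_res V ct q : zopen_in X V -> V `<=` nonzero_dom 'X_(ct.1) -> V q ->
  D V (fun i => frac_fun (tuple_of ct i)) q = value ct q.
Proof.
move=> Vo VX Vq; have ho : zopen_in X (nonzero_dom 'X_(ct.1)).
  exact: nonzero_open (var_homog _ _).
symmetry; apply: (form_res hD ho Vo) => // i.
  by apply: frac_regular; apply: tuple_on.
by apply: frac_regular; apply: tuple_on.
Qed.

Let vol_good q ct : good q ct -> vol q f e (delta_mx 0 ct.1) (tuple_of ct) != 0.
Proof.
move=> /andP[qc]; rewrite minorE // mulf_eq0 negb_or => /andP[_].
by [].
Qed.

Let residue_at_eq q ct ct' : X q -> good q ct -> good q ct' ->
  residue_at ct q = residue_at ct' q.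
Proof.
case: ct ct' => [c t] [c' t'] Xq g g'.
have := g; rewrite /good /= => /andP[qc qm]; have := g'; rewrite /good /= => /andP[qc' qm'].
pose V := nonzero_dom ('X_c * 'X_c').
have VE x : V x -> x c != 0 /\ x c' != 0.
  by case=> _; rewrite mevalM !mevalXU mulf_eq0 negb_or => /andP[].
have Vo : zopen_in X V by apply: nonzero_open (dhomogM (var_homog _ _) (var_homog _ _)).
have Vq : V q by split=> //; rewrite mevalM !mevalXU mulf_neq0.
have VX : V `<=` nonzero_dom 'X_c.
  by move=> x Vx; split; [case: Vx | rewrite mevalXU; case: (VE x Vx)].
have VX' : V `<=` nonzero_dom 'X_c'.
  by move=> x Vx; split; [case: Vx | rewrite mevalXU; case: (VE x Vx)].
have on := @tuple_on V (c, t) VX; have on' := @tuple_on V (c', t') VX'.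
have E1 := forms_proportional hD Vo Vq fd fX (fun x Vx => (VE x Vx).1) on on' (vol_good g).
have v := @value_res V (c, t) q Vo VX Vq; have v' := @value_res V (c', t') q Vo VX' Vq.
rewrite v v' in E1.
have E2 := vol_change Vo Vq fd fX e (delta_mx 0 c) (delta_mx 0 c') qc on'.
have ptE j : (delta_mx 0 j *m pt_col q : 'M[C]_1) 0 0 = q j by rewrite -rowE !mxE.
rewrite !ptE in E2.
have xn := vol_good g; have zn := vol_good g'.
have mE := minorE f e t qc; have mE' := minorE f e t' qc'.
exact: (residue_algebra qc qc' xn zn E1 E2 mE mE').
Qed.

Lemma residueE q c (t : {ffun 'I_k -> 'I_n.+1}) : X q -> q c != 0 ->
  (minor f e c t).@[q] != 0 ->
  residue q = D (nonzero_dom 'X_c) (fun i => frac_fun (chart_coord C c (t i))) q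
    * q c ^+ (2 * k + 1) / (minor f e c t).@[q].
Proof.
move=> Xq qc qm; have g : good q (c, t) by rewrite /good /= qc qm.
rewrite /residue; case: pickP => [ct gct|/(_ (c, t))]; last by rewrite g.
exact: (residue_at_eq Xq gct g).
Qed.

(** In a chart the residue is a section of O(s) times x_c^(2k+1), divided by a
    minor of degree sum (d_l - 1) + k. *)
Lemma residue_section (m : int) :
  m + (\sum_l (d l).-1 + k)%N%:Z = s + (2 * k + 1)%N%:Z ->
  twist_section m residue_dom residue.
Proof.
move=> mE q [Xq [[c t] /andP[/= qc qm]]].
have co : zopen_in X (nonzero_dom 'X_c) := nonzero_open (var_homog _ c).
have cq : nonzero_dom 'X_c q by split=> //; rewrite mevalXU.
have hreg i : regular_on (nonzero_dom 'X_c) (frac_fun (chart_coord C c (t i))).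
  by apply: frac_regular; apply: frac_coord => x [_]; rewrite mevalXU.
have [dg [dh [g [h [E gd hd hq DE]]]]] := form_section hD co hreg cq.
pose M := minor f e c t.
have Xch (j : nat) : ('X_c : {mpoly C[n.+1]}) ^+ j \is j.-homog.
  by have := dhomogMn j (var_homog C c); rewrite mul1n.
exists (dg + (2 * k + 2))%N, (dh + (\sum_l (d l).-1 + k) + 1)%N.
exists (g * 'X_c ^+ (2 * k + 2)), (h * M * 'X_c).
have XcE x : ('X_c : {mpoly C[n.+1]}).@[x] = x c by rewrite mevalXU.
split.
- rewrite !PoszD E; lia.
- exact: dhomogM.
- apply: dhomogM; last exact: var_homog.
  by apply: dhomogM => //; exact: minor_homog fd _ _.
- by rewrite !mevalM XcE !mulf_neq0.
move=> x [Xx _]; rewrite !mevalM XcE !mulf_eq0 !negb_or => /andP[/andP[hx Mx] xc].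
rewrite (residueE Xx xc Mx) DE //; last by split=> //; rewrite XcE.
have -> : (2 * k + 2 = (2 * k + 1).+1)%N by rewrite addnS.
rewrite rmorphXn /= XcE exprS -/M; move: (_ ^+ (2 * k + 1)) => y.
by field; rewrite hx Mx xc.
Qed.

(** Where the residue vanishes every form does, since forms are proportional to
    the volume. *)
Lemma residue_eq0 q m G (b : 'I_k -> {mpoly C[n.+1]} * {mpoly C[n.+1]}) :
  residue_dom q -> residue q = 0 -> G \is m.-homog -> G.@[q] != 0 ->
  (forall i, frac_on (nonzero_dom G) (b i)) ->
  D (nonzero_dom G) (fun i => frac_fun (b i)) q = 0.
Proof.
move=> [Xq [[c t] g]] res0 Gm Gq bon; have := g; rewrite /good => /andP[/= qc qm].
pose V := nonzero_dom (G * 'X_c).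
have VE x : V x -> G.@[x] != 0 /\ x c != 0.
  by case=> _; rewrite mevalM mevalXU mulf_eq0 negb_or => /andP[].
have Vo : zopen_in X V by apply: nonzero_open (dhomogM Gm (var_homog _ _)).
have Vq : V q by split=> //; rewrite mevalM mevalXU mulf_neq0.
have VX : V `<=` nonzero_dom 'X_c.
  by move=> x Vx; split; [case: Vx | rewrite mevalXU; case: (VE x Vx)].
have VG : V `<=` nonzero_dom G by move=> x Vx; split; [case: Vx | case: (VE x Vx)].
have bV i : frac_on V (b i).
  by have [j [h1 h2 h3]] := bon i; exists j; split=> // x /VG; apply: h3.
have v := @value_res V (c, t) q Vo VX Vq.
have v0 : value (c, t) q = 0.
  move: res0; rewrite (residueE Xq qc qm) => /eqP.
  rewrite !mulf_eq0 invr_eq0 (negPf qm) expf_eq0 (negPf qc) andbF !orbF.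
  by move/eqP.
have := forms_proportional hD Vo Vq fd fX (fun x Vx => (VE x Vx).2)
  (@tuple_on V (c, t) VX) bV (vol_good g).
rewrite v v0 mul0r => /eqP; rewrite mulf_eq0 (negPf (vol_good g)) orbF => /eqP <-.
apply: (form_res hD (nonzero_open Gm) Vo VG) => // i; apply: frac_regular => //.
Qed.

End Residue.

(** * The degree bound *)

Theorem pfaff_degree_bound (C : closedFieldType) (n k : nat) (hk0 : (0 < k)%N)
    (hkn : (k < n)%N) (X : set (coords C n)) (d : 'I_(n - k) -> nat)
    (F : pfaff_field C n k) :
  complete_intersection_variety k X d -> nonsingular_in_codim1 X ->
  pfaff_invariant F X ->
  (\sum_(j < n - k) d j)%N%:Z <= pfaff_degree F + n%:Z - k%:Z + 1.
Proof.
move=> [Xirr [[Z0 chZ0] dimX] [f [hf fgen]]] hsing [nsing [D hD DF]].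
have [Xcl [x0 Xx0] _] := Xirr; have Xpr := zclosed_proj Xcl.
have fX i q : X q -> (f i).@[q] = 0.
  move=> Xq; have [_ h] := fgen (f i); apply: h => //.
  exists (fun j => (j == i)%:R); rewrite (bigD1 i) //= eqxx mul1r big1 ?addr0 //.
  by move=> j /negPf ->; rewrite mul0r.
have fd i : f i \is (d i).-homog by case: (hf i).
have d0 i : (0 < d i)%N.
  rewrite lt0n; apply/eqP => di; have [fn] := hf i; rewrite di => /homog0_const fC.
  by case/eqP: fn; have := fX i x0 Xx0; rewrite fC mevalC => ->; rewrite mpolyC0.
have e : ((n - k).+1 + k = n.+1)%N by rewrite addSn subnK // ltnW.
pose s := pfaff_twist F.
pose m := s + (2 * k + 1)%N%:Z - (\sum_l (d l).-1 + k)%N%:Z.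
have sumd : (\sum_j d j = \sum_l (d l).-1 + (n - k))%N.
  transitivity (\sum_l (d l).-1 + \sum_(l < n - k) 1)%N.
    by rewrite -big_split /=; apply: eq_bigr => i _; rewrite addn1 prednK.
  by rewrite sum1_card card_ord.
rewrite sumd /pfaff_degree -/s leNgt; apply/negP => hlt.
have m0 : m < 0 by rewrite /m; lia.
set U := residue_dom X f e.
have Uo : zopen_in X U := residue_dom_open Xirr e fd.
have codim W : irreducible_closed W -> W `<=` X `\` U ->
    exists2 Z, irreducible_chain X 2 Z & Z 0%N = W.
  move=> Wirr WU; apply: hsing => // q /WU[Xq nU]; split=> // ns; apply: nU.
  have rkJ : \rank (\matrix_(i < n - k) grad q (f i)) = (n - k)%N.
    apply/eqP; rewrite eqn_leq rank_leq_row leq_subLR addnC /=.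
    apply: (nonsingular_jacobian_rank Xirr Xq _ _ dimX ns).
      by move=> i x Xx; apply: fX.
    by move=> g hg; have [h _] := fgen g; apply: h.
  have [c qc] := Xpr q Xq.
  have [t qt] := exists_minor e fd qc (fun l => fX l q Xq) rkJ.
  split=> //; exists (c, [ffun i => t i]); rewrite qc /=.
  by have -> : [ffun i => t i] = t :> ('I_k -> 'I_n.+1) by apply/funext => i; rewrite ffunE.
have Une : U !=set0.
  apply: contrapT => U0.
  have [|Z [_ Zsub ZX] Z0E] := codim X Xirr.
    by move=> q Xq; split=> // Uq; apply: U0; exists q.
  have [_ nZ] := Zsub 0%N isT; apply: nZ; rewrite Z0E.
  by apply: subset_trans ZX; case: (Zsub 1%N isT).
(* the residue is a section of O(m), and m < 0 *)
have res0 q : U q -> residue X D f e q = 0.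
  have mE : m = - (`|m|%N)%:Z by lia.
  have sec : twist_section (- (`|m|%N)%:Z) U (residue X D f e).
    by rewrite -mE; apply: (residue_section hD Xirr fd fX); rewrite /m subrK.
  apply: (negative_section_eq0 Xirr Uo _ sec) => //; first by lia.
  by case: (k) hk0 chZ0 => // k' _ /irreducible_chain_last.
have [p [Xp np]] : exists p, X p /\ ~ pfaff_sing F p.
  by apply: contrapT => h; apply: nsing => p Xp; apply: contrapT => np; apply: h; exists p.
have [U' [a [U'o U'p areg a1]]] : exists U' a,
    [/\ zopen_in (@projective_space C n) U', U' p,
        forall i, regular_on U' (a i) & pfaff_map F U' a p = 1].
  apply: contrapT => h; apply: np; split; first exact: Xpr.
  by move=> hc; apply: h; have [U' [a ha]] := hc 1; exists U', a.
pose V0 := U' `&` X.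
have V0o : zopen_in X V0.
  have [Z Zcl UE] := U'o; exists Z => //; rewrite /V0 UE.
  by apply/seteqP; split=> q; [case=> -[] | case=> Xq nZ; do 2 split=> //; apply: Xpr].
have V0p : V0 p by [].
have aV0 i : regular_on V0 (a i) by apply: regular_sub (areg i) => q [].
have [_ [_ [g [h [_ _ _ hp DE]]]]] := form_section hD V0o aV0 V0p.
have gp : g.@[p] != 0.
  have := DE p V0p hp; rewrite DF // a1 => /esym/eqP.
  by apply: contraTneq => ->; rewrite mul0r eq_sym oner_eq0.
have [F0 [[d' F0d] F0p F0V]] := zopen_basis Xirr V0o V0p.
have [q [Uq Gq]] : exists q, U q /\ (g * h * F0).@[q] != 0.
  apply: contrapT => hno.
  have : vanishing X (g * h * F0).
    apply: (vanishing_open Xirr Uo Une) => q Uq.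
    by apply/eqP; apply: contraT => qn; case: hno; exists q.
  by move=> /(_ p Xp) /eqP; rewrite !mevalM !mulf_eq0 (negPf gp) (negPf hp) (negPf F0p).
move: Gq; rewrite !mevalM !mulf_eq0 !negb_or => /andP[/andP[gq hq] F0q].
have Xq : X q by case: Uq.
have V0q : V0 q by exact: F0V.
have [U'q _] := V0q.
have local i : exists t : {mpoly C[n.+1]} * {mpoly C[n.+1]},
    [/\ exists2 j, t.1 \is j.-homog & t.2 \is j.-homog, t.2.@[q] != 0 &
        forall x, U' x -> t.2.@[x] != 0 -> a i x = frac_fun t x].
  have [dg [dh [g1 [h1 [E g1d h1d h1q aE]]]]] := areg i q U'q.
  exists (g1, h1); split=> //; exists dg => //=.
  by move: E; rewrite addr0 => -[->].
have [b hb] := choice local.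
(* where G != 0 the forms and all the a i are given by one expression *)
pose G := F0 * \prod_i (b i).2.
have [d'' Gd] : exists j, G \is j.-homog.
  have [j hj] : exists j, \prod_i (b i).2 \is j.-homog.
    elim/big_ind: _ => [|x y [j hx] [l hy]|i _].
    - by exists 0%N; exact: dhomog1.
    - by exists (j + l)%N; exact: dhomogM.
    - by have [[j _ hj] _ _] := hb i; exists j.
  by exists (d' + j)%N; exact: dhomogM.
have GE x : G.@[x] != 0 -> F0.@[x] != 0 /\ forall i, (b i).2.@[x] != 0.
  rewrite mevalM mulf_eq0 negb_or => /andP[F0x]; rewrite rmorph_prod /= => Px.
  by split=> // i; move: Px; apply: contraNneq => b0; rewrite (bigD1 i) //= b0 mul0r.
have Gq : G.@[q] != 0.
  rewrite mevalM mulf_neq0 // rmorph_prod; apply/prodf_neq0 => i _.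
  by case: (hb i).
have bon i : frac_on (nonzero_dom X G) (b i).
  have [[j h1 h2] _ _] := hb i; exists j; split=> // x [_ /GE[_]]; exact.
have Do : zopen_in X (nonzero_dom X G) := zopen_nonzero Xpr Gd.
have GV0 : nonzero_dom X G `<=` V0 by move=> x [Xx /GE[F0x _]]; apply: F0V.
have D0 := residue_eq0 hD Xirr fd fX Uq (res0 q Uq) Gd Gq bon.
have : D V0 a q = 0.
  rewrite -D0; apply: (form_res hD V0o Do GV0) => //.
    by move=> i; apply: frac_regular.
  move=> i x [Xx Gx]; have [F0x bx] := GE x Gx.
  have [U'x _] : V0 x by apply: F0V.
  by have [_ _] := hb i; apply.
rewrite DE //.
by move/eqP; rewrite mulf_eq0 invr_eq0 (negPf gq) (negPf hq).
Qed.

Theorem corollary9 (R : realType) (n k : nat) (hk0 : (0 < k)%N)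
    (hkn : (k < n)%N) (X : set (coords R[i] n)) (d : 'I_(n - k) -> nat)
    (F : pfaff_field R[i] n k)
    (hX : complete_intersection_variety k X d)
    (hsing : nonsingular_in_codim1 X)
    (hF : pfaff_invariant F X) :
  (\sum_(j < n - k) d j)%N%:Z <= pfaff_degree F + n%:Z - k%:Z + 1.
Proof. exact: (pfaff_degree_bound hk0 hkn hX hsing hF). Qed.
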